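(* Let $t\geqslant s\geqslant 2$ be fixed integers and let $p\in(0,1)$ be constant. Then, with high probability, $$\mathrm{sat}\big(\mathbb{G}(n,p),K_{s,t}\big)\geqslant\left(\max\left\{\frac{2s+t-3}{2},\ \frac{t-s}{4p^{s-1}}+\frac{s-1}{2}\right\}+o(1)\right)n.$$
   Context: All graphs are finite, undirected, without loops or multiple edges. $K_{s,t}$ is the complete bipartite graph with parts of sizes $s$ and $t$. For graphs $G$ and $F$, a graph is $F$-free if it has no subgraph (not necessarily induced) isomorphic to $F$. A spanning subgraph $H$ of $G$ is an $F$-saturated subgraph of $G$ if $H$ is $F$-free and adding any edge of $E(G)\setminus E(H)$ to $H$ creates a copy of $F$. $\mathrm{sat}(G,F)$ denotes the minimum number of edges in an $F$-saturated subgraph of $G$. $\mathbb{G}(n,p)$ is the Erdős–Rényi random graph on a fixed vertex set of size $n$, where every two distinct vertices are adjacent independently with probability $p$. ''With high probability'' means with probability tending to $1$ as $n\to\infty$. The term $o(1)$ denotes a function of $n$ (depending on the fixed $p,s,t$) tending to $0$ as $n\to\infty$. *)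

(* Defs.v *)
(* In this order, [set0], [subsetP] and the like are those of finset. *)
From mathcomp Require Import all_classical all_reals all_analysis.
From mathcomp Require Import all_boot all_order all_algebra.

Set Implicit Arguments.
Unset Strict Implicit.
Unset Printing Implicit Defensive.

Import Order.TTheory GRing.Theory Num.Theory.
Import numFieldNormedType.Exports.

Local Open Scope nat_scope.

(* A graph with vertex set a finite type [T] is identified with its edge set
   [G : {set {set T}}], a subset of [pairs T]. Hence [H \subset G] says that
   [H] is a spanning subgraph of [G], and [#|H|] is its number of edges. *)
Definition pairs (T : finType) : {set {set T}} := [set e : {set T} | #|e| == 2].

Definition Kst (s t : nat) : {set {set ('I_s + 'I_t)%type}} :=
  [set [set inl i; inr j] | i : 'I_s, j : 'I_t].

(* A not necessarily induced subgraph isomorphic to [F] is the image of [F]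
   under an injective map of vertices that sends edges to edges. *)
Definition has_copy (U T : finType) (F : {set {set U}}) (H : {set {set T}}) :
    bool :=
  [exists f : {ffun U -> T}, injectiveb f && [forall e in F, f @: e \in H]].

Definition saturated (U T : finType) (F : {set {set U}})
    (G H : {set {set T}}) : bool :=
  [&& H \subset G, ~~ has_copy F H
    & [forall e in G :\: H, has_copy F (e |: H)]].

(* The default value [#|G|] plays no role when [F] has an edge: saturated
   subgraphs then exist (see [sat_attained]) and have at most [#|G|] edges. *)
Definition sat (U T : finType) (G : {set {set T}}) (F : {set {set U}}) : nat :=
  \big[minn/#|G|]_(H : {set {set T}} | saturated F G H) #|H|.

Lemma sat_le (U T : finType) (F : {set {set U}}) (G H : {set {set T}}) :
  saturated F G H -> sat G F <= #|H|.
Proof.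
move=> satH; rewrite /sat; have := mem_index_enum H.
elim: (index_enum _) => // K r IHr; rewrite inE big_cons.
case/predU1P => [<-|/IHr le_r]; first by rewrite satH geq_minl.
by case: ifP => // _; rewrite geq_min le_r orbT.
Qed.

Lemma saturated_exists (U T : finType) (F : {set {set U}})
    (G : {set {set T}}) :
  F != set0 -> exists H : {set {set T}}, saturated F G H.
Proof.
case/set0Pn=> e0 e0F.
pose P := [pred H : {set {set T}} | (H \subset G) && ~~ has_copy F H].
have P0 : P set0.
  rewrite /= sub0set /=; apply/existsP => -[f /andP[_ /forall_inP/(_ _ e0F)]].
  by rewrite inE.
have [H PH maxH] := @arg_maxnP _ set0 P (fun H => #|H|) P0.
exists H; move/andP: (PH) => [HG HF]; rewrite /saturated HG HF /=.
apply/forall_inP => e /setDP[eG eH].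
case: (boolP (has_copy F (e |: H))) => // nc.
have PeH : P (e |: H) by rewrite inE nc subUset sub1set eG HG.
by have := maxH _ PeH; rewrite /= cardsU1 eH add1n ltnn.
Qed.

Lemma sat_attained (U T : finType) (F : {set {set U}}) (G : {set {set T}}) :
  F != set0 -> exists2 H : {set {set T}}, saturated F G H & #|H| = sat G F.
Proof.
move=> /(saturated_exists G)[H0 satH0].
have [H satH minH] := @arg_minnP _ H0 (saturated F G) (fun H => #|H|) satH0.
exists H => //; apply/eqP; rewrite eqn_leq sat_le // andbT /sat.
apply: (big_ind (fun m => #|H| <= m)) => //.
- by case/and3P: satH => HG _ _; rewrite subset_leq_card.
- by move=> x y xH yH; rewrite leq_min xH.
Qed.

Local Open Scope ring_scope.

Definition gnp_weight (R : realType) (n : nat) (p : R)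
    (G : {set {set 'I_n}}) : R :=
  \prod_(e in pairs 'I_n) (if e \in G then p else 1 - p).

Definition gnp_prob (R : realType) (n : nat) (p : R)
    (A : pred {set {set 'I_n}}) : R :=
  \sum_(G in powerset (pairs 'I_n) | A G) gnp_weight p G.

Lemma gnp_prob_total (R : realType) (n : nat) (p : R) :
  gnp_prob (n := n) p xpredT = 1.
Proof.
rewrite /gnp_prob /gnp_weight.
pose f (e : {set 'I_n}) : R := if e \in pairs 'I_n then p else 0.
pose g (e : {set 'I_n}) : R := if e \in pairs 'I_n then 1 - p else 1.
have fg1 : \prod_e (f e + g e) = 1.
  rewrite big1 // => e _; rewrite /f /g.
  by case: ifP => _; rewrite ?add0r // addrC subrK.
rewrite -[RHS]fg1 bigA_distr big_mkcond; apply: eq_bigr => G _.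
rewrite powersetE andbT; case: ifPn => [/subsetP sG|/subsetPn[e eG eP]].
  rewrite big_mkcond; apply: eq_bigr => e _; rewrite /f /g.
  by case: (boolP (e \in G)) => [/sG ->|] //; case: ifP.
by rewrite (bigD1 e) //= eG /f (negPf eP) mul0r.
Qed.

Definition whp (R : realType) (p : R)
    (A : forall n : nat, pred {set {set 'I_n}}) : Prop :=
  ((fun n : nat => gnp_prob p (A n)) @ \oo --> (1 : R))%classic.

(* Main.v *)
(* Let [H] be a saturated subgraph of [G] with at most [Cn] edges. By
   pigeonhole over scales there is a degree threshold such that few edges of [H]
   meet a vertex in a long range of degrees just below it; call the boundedly many
   vertices above it hubs. Since [H] has no [K_(s,t)], the Kovari-Sos-Turan argument shows that
   almost no pair of vertices is joined by a 3-edge path avoiding the hubs, and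
   that almost every vertex has at most [s - 1] hub neighbours. So for almost
   every edge [uv] of [G], up to exchanging [u] and [v], the copy of [K_(s,t)]
   created by [uv] has [u] and the [s - 1] hub neighbours of [v] on one side, and
   on the other side [v] and [t - 1] neighbours of [u]: say that [u] serves [v].
   - Whether [u] serves [v] depends on [v] only through its hub neighbours, and
     linear sets span many edges of [G], so almost every vertex serves itself. It
     then has [s - 1] hub neighbours and at least [t - 1] others, whence the
     constant [(s - 1) + (t - 1) / 2].
   - Let [u] serve [r] different [(s - 1)]-sets of hubs. Each of them supplies at
     least [t - s] neighbours of [u] that are not hubs, and these are distinct for
     distinct sets, so [u] has degree at least [s - 1 + (t - s) r]. Through one
     such set [u] serves only about [p^s n] of its about [p n] neighbours in [G],
     so [r] is on average at least about [1 / (2 p^(s-1))]. *)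
Require Import Defs.
From mathcomp Require Import all_classical all_reals all_analysis.
From mathcomp Require Import all_boot all_order all_algebra.
From mathcomp Require Import zify ring lra.

Set Implicit Arguments.
Unset Strict Implicit.
Unset Printing Implicit Defensive.

Import Order.TTheory GRing.Theory Num.Theory.
Import numFieldNormedType.Exports.

Local Open Scope nat_scope.

(** * Graphs and copies of complete bipartite graphs *)

Definition nbr (T : finType) (H : {set {set T}}) (u : T) : {set T} :=
  [set v | [set u; v] \in H].

Definition cnbr (T : finType) (H : {set {set T}}) (Q : {set T}) : {set T} :=
  [set v | Q \subset nbr H v].

Section Graph.

Variables (T : finType) (H : {set {set T}}).
Hypothesis graphH : H \subset pairs T.

Lemma nbr_sym u v : (u \in nbr H v) = (v \in nbr H u).
Proof. by rewrite !inE setUC. Qed.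

Lemma nbr_irr u : u \in nbr H u = false.
Proof.
apply/negbTE/negP; rewrite inE => /(subsetP graphH).
by rewrite inE setUid cards1.
Qed.

Lemma handshake : \sum_u #|nbr H u| = 2 * #|H|.
Proof.
have inc u : #|nbr H u| = \sum_(e in H) (u \in e).
  have -> : \sum_(e in H) (u \in e) = #|[set e in H | u \in e]|.
    rewrite -sum1_card big_mkcond [RHS]big_mkcond /=; apply: eq_bigr => e _.
    by rewrite inE; case: (e \in H); case: (u \in e).
  have inj : injective (fun v => [set u; v]).
    move=> v w /setP e; have := e v; have := e w; rewrite !inE !eqxx !orbT.
    by case: (w =P u) => [->|_]; case: (v =P u) => [->|_] //= /eqP // _ /eqP.
  rewrite -(card_imset _ inj); apply: eq_card => e; rewrite !inE.
  apply/imsetP/andP => [[v]|[eH ue]].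
    by rewrite inE => vH ->; rewrite vH !inE eqxx.
  have := subsetP graphH _ eH; rewrite inE => /cards2P[x [y [_ def]]].
  move: ue eH; rewrite def !inE => /orP[]/eqP-> eH; first by exists y; rewrite ?inE.
  by exists x; rewrite ?inE setUC.
under eq_bigr do rewrite inc.
rewrite exchange_big /= -[#|H|]sum1_card big_distrr /=; apply: eq_bigr => e eH.
have /eqP <- : #|e| == 2 by have := subsetP graphH _ eH; rewrite inE.
by rewrite muln1 -sum1_card [RHS]big_mkcond; apply: eq_bigr => u _; case: (u \in e).
Qed.

Lemma sum_nbr (A : {set T}) : \sum_(u in A) #|nbr H u| <= 2 * #|H|.
Proof. by rewrite -handshake [leqRHS](bigID (mem A)) leq_addr. Qed.

End Graph.

Section Copies.

Variables (T : finType) (H : {set {set T}}) (s t : nat).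
Hypothesis graphH : H \subset pairs T.

Lemma inj_of_card (k : nat) (A : {set T}) :
  k <= #|A| -> exists f : 'I_k -> T, injective f /\ forall i, f i \in A.
Proof.
move=> cA; exists (fun i => enum_val (widen_ord cA i)); split.
  by move=> i j /enum_val_inj /(congr1 val) /= /val_inj.
by move=> i; apply: enum_valP.
Qed.

(** The two sides are automatically disjoint because a graph has no loops. The path and hub
    estimates use freeness in this form. *)
Lemma free_cnbr (Y : {set T}) :
  ~~ has_copy (Kst s t) H -> #|Y| = s -> #|cnbr H Y| < t.
Proof.
move=> free cY; rewrite ltnNge; apply: contra free => /inj_of_card[g [ginj gN]].
have /inj_of_card[f [finj fY]] : s <= #|Y| by rewrite cY.
have fg i j : f i \in nbr H (g j).
  by have := gN j; rewrite inE => /subsetP; apply.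
have fNg i j : f i != g j.
  by apply/eqP => e; have := fg i j; rewrite e nbr_irr.
apply/existsP.
exists [ffun x : 'I_s + 'I_t => match x with inl i => f i | inr j => g j end].
apply/andP; split.
  apply/injectiveP => -[i|j] [i'|j']; rewrite !ffunE.
  - by move/finj->.
  - by move/eqP; rewrite (negPf (fNg _ _)).
  - by move/esym/eqP; rewrite (negPf (fNg _ _)).
  - by move/ginj->.
apply/forall_inP => e /imset2P[i j _ _ ->].
by rewrite imsetU1 imset_set1 !ffunE; have := fg i j; rewrite nbr_sym inE.
Qed.

(** A copy that misses the new edge would lie in [H]. By injectivity exactly one edge of the copy is
    the new one, so deleting [a] from the [s]-side and [b] from the [t]-side leaves [S'] and [T'],
    with all other edges of the copy in [H]. *)
Lemma copy_add_edge (u v : T) :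
    ~~ has_copy (Kst s t) H -> has_copy (Kst s t) ([set u; v] |: H) ->
  exists a b (S' T' : {set T}),
    [/\ (a = u /\ b = v) \/ (a = v /\ b = u),
        #|S'| = s.-1, #|T'| = t.-1, S' \subset nbr H b
      & T' \subset nbr H a /\ T' \subset cnbr H S'].
Proof.
move=> free /existsP[f /andP[/injectiveP finj /forall_inP fE]].
have mem_e i j : [set f (inl i); f (inr j)] \in [set u; v] |: H.
  have /fE : [set inl i; inr j] \in Kst s t by apply: imset2_f.
  by rewrite imsetU1 imset_set1.
have [/existsP[i /existsP[j /eqP e]]|none] :=
  boolP [exists i, exists j, [set f (inl i); f (inr j)] == [set u; v]]; last first.
  case/negP: free; apply/existsP; exists f; apply/andP; split; first exact/injectiveP.
  apply/forall_inP => e /imset2P[i j _ _ ->].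
  rewrite imsetU1 imset_set1; have := mem_e i j; rewrite in_setU1 => /predU1P[e'|//].
  by case/negP: none; apply/existsP; exists i; apply/existsP; exists j; apply/eqP.
have memH i' j' : (i' != i) || (j' != j) -> [set f (inl i'); f (inr j')] \in H.
  move=> ne; have := mem_e i' j'; rewrite -e in_setU1 => /predU1P[/setP e'|//].
  have := e' (f (inl i')); have := e' (f (inr j')).
  rewrite !inE !eqxx ?orbT /= !(inj_eq finj) /=.
  move=> /esym/eqP[ej] /esym; rewrite orbF => /eqP[ei].
  by rewrite ei ej !eqxx in ne.
exists (f (inl i)), (f (inr j)), [set f (inl i') | i' in [set~ i]],
  [set f (inr j') | j' in [set~ j]]; split.
- have /setP e' := e; have := e' (f (inl i)); have := e' (f (inr j)).
  rewrite !inE !eqxx ?orbT /=.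
  have fne : f (inl i) != f (inr j) by rewrite (inj_eq finj).
  move=> /esym/orP[]/eqP e1 /esym/orP[]/eqP e2; rewrite e1 e2.
  + by rewrite e1 e2 eqxx in fne.
  + by right.
  + by left.
  + by rewrite e1 e2 eqxx in fne.
- by rewrite card_imset ?cardsC1 ?card_ord // => x y /finj[].
- by rewrite card_imset ?cardsC1 ?card_ord // => x y /finj[].
- apply/subsetP => x /imsetP[i']; rewrite !inE => ne ->.
  by rewrite setUC memH // ne.
- split; apply/subsetP => x /imsetP[j']; rewrite !inE => ne ->.
    by rewrite memH // ne orbT.
  apply/subsetP => y /imsetP[i']; rewrite !inE => ne' ->.
  by rewrite setUC memH // ne'.
Qed.

End Copies.

(** * Short paths in graphs without complete bipartite subgraphs *)

Lemma card_bigcup_le (I T : finType) (A : {set I}) (E : I -> {set T})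
    (e : I -> nat) :
  (forall i, i \in A -> #|E i| <= e i) ->
  #|\bigcup_(i in A) E i| <= \sum_(i in A) e i.
Proof.
move=> Ee; apply: (big_ind2 (fun (X : {set T}) k => #|X| <= k)) => //.
  by rewrite cards0.
move=> X k Y l Xk Yl; rewrite (leq_trans (leq_card_setU _ _)) //.
exact: leq_add.
Qed.

Section Paths.

Variables (T : finType) (H : {set {set T}}) (s t : nat).
Hypothesis free : forall Y : {set T}, #|Y| = s -> #|cnbr H Y| < t.
Variables (B : {set T}) (m : nat).
Hypothesis low : forall x, x \in B -> m * #|nbr H x| <= #|T|.

Local Notation d := (fun x => #|nbr H x|).
Local Notation F := (\sum_(x in B) d x).

(** The number of walks of length 2 from [x] with middle vertex in [B]. Thus [d x * wdeg x] counts
    walks of length 3 with second vertex [x] and third vertex in [B]. *)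
Definition wdeg x := \sum_(y in B :&: nbr H x) #|nbr H y|.

Definition path3 u v :=
  [exists x in B :&: nbr H u, exists y in B :&: nbr H x, v \in nbr H y].

(* Kovari-Sos-Turan with weights: expanding one factor [wdeg x] adds one more
   vertex [y] to [Y]. The summand [s * l] pays for the [y] already in [Y]. *)
Lemma sum_wdeg_exp_le (l : nat) (Y : {set T}) : #|Y| + l = s ->
  m * (\sum_(x in B :&: cnbr H Y) d x * wdeg x ^ l) <= #|T| * F ^ l * (t + s * l).
Proof.
have wdeg_le x : wdeg x <= F.
  by rewrite /wdeg [leqRHS](big_setID (nbr H x)) leq_addr.
elim: l Y => [|l IHl] Y cY.
  rewrite muln1 muln0 addn0; under eq_bigr do rewrite muln1.
  rewrite big_distrr /= mulnC.
  apply: leq_trans (_ : \sum_(x in B :&: cnbr H Y) #|T| <= _).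
    by apply: leq_sum => x /setIP[xB _]; apply: low.
  rewrite sum_nat_const leq_mul2r; apply/orP; right.
  by rewrite (leq_trans (subset_leq_card (subsetIr _ _))) // ltnW // free // -cY addn0.
have -> : \sum_(x in B :&: cnbr H Y) d x * wdeg x ^ l.+1 =
    \sum_(y in B) d y * \sum_(x in B :&: cnbr H (y |: Y)) d x * wdeg x ^ l.
  under eq_bigr => x _ do rewrite expnS {1}/wdeg mulnCA big_distrl /=.
  under [RHS]eq_bigr do rewrite big_distrr /=.
  rewrite (exchange_big_dep (mem B)) /=; last by move=> x y _ /setIP[].
  apply: eq_bigr => y yB; apply: eq_bigl => x.
  by rewrite !inE subUset sub1set !inE yB /= andbAC andbA.
(* The trivial bound, from [wdeg x <= F], for the [y] in [Y]: there [y |: Y] does not grow and the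
   induction hypothesis does not apply. *)
pose D := \sum_(x in B :&: cnbr H Y) d x * wdeg x ^ l.
have DF : D <= F ^ l.+1.
  rewrite expnS big_distrl /= [leqRHS](big_setID (cnbr H Y)) /=.
  apply/(leq_trans _ (leq_addr _ _))/leq_sum => x _ /=.
  by rewrite leq_mul2l; apply/orP; right; case: (l) => // k; rewrite leq_exp2r.
rewrite (bigID (mem Y)) /= mulnDr.
have -> : #|T| * F ^ l.+1 * (t + s * l.+1) =
    s * (#|T| * F ^ l.+1) + F * (#|T| * F ^ l * (t + s * l)) by rewrite expnS; lia.
apply: leq_add; rewrite big_distrr /=; last first.
  rewrite [leqRHS]big_distrl /= [leqRHS](bigID (mem Y)) /=.
  apply/(leq_trans _ (leq_addl _ _))/leq_sum => y /andP[yB yY].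
  by rewrite mulnCA leq_mul2l IHl ?orbT // cardsU1 yY -cY; lia.
apply: leq_trans (_ : \sum_(y in Y) #|T| * F ^ l.+1 <= _); last first.
  by rewrite sum_nat_const leq_mul2r -cY leq_addr orbT.
rewrite big_mkcondl /=; apply: leq_sum => y yY; case: ifP => // yB.
have -> : y |: Y = Y by apply/setUidPr; rewrite sub1set.
by rewrite mulnA leq_mul // low.
Qed.

(** Vertices with [wdeg x] at most [n / r] contribute at most [C * n ^ 2 / r] walks. The others are
    controlled by the moment of order [s], bounded by [sum_wdeg_exp_le] for empty [Y]; the size of
    [m] reduces their share to [n ^ 2 / r]. *)
Lemma sum_path_le (r C : nat) :
    0 < s -> 0 < m -> 0 < #|T| -> F <= C * #|T| ->
    r ^ s * C ^ s * (t + s * s) <= m ->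
  r * (\sum_(x in B) d x * wdeg x) <= C.+1 * #|T| ^ 2.
Proof.
move=> s0 m0 n0 FC rm; set n := #|T|; set P := \sum_(x in B) _.
(* In either case of [r * wdeg x <= n], [n^(s-1) * (r * wdeg x)] is at most
   one of [n^s] and [(r * wdeg x)^s]. *)
have split_wdeg x : n ^ s.-1 * (r * wdeg x) <= n ^ s + r ^ s * wdeg x ^ s.
  rewrite -expnMn -(prednK s0) !expnS /=; case: (leqP (r * wdeg x) n) => h.
    by rewrite mulnC (leq_trans _ (leq_addr _ _)) // leq_mul2r h orbT.
  rewrite mulnC (leq_trans _ (leq_addl _ _)) // leq_mul2l; apply/orP; right.
  by case: (s.-1) => // k; rewrite leq_exp2r // ltnW.
have phi : m * (\sum_(x in B) d x * wdeg x ^ s) <= n * (C * n) ^ s * (t + s * s).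
  apply: leq_trans (_ : n * F ^ s * (t + s * s) <= _); last first.
    by rewrite leq_mul2r leq_mul2l leq_exp2r // FC !orbT.
  have := @sum_wdeg_exp_le s set0; rewrite cards0 => /(_ erefl).
  congr (m * _ <= _); apply: eq_bigl => x.
  by rewrite !inE sub0set andbT.
have k0 : 0 < m * n ^ s.-1 by rewrite muln_gt0 m0 expn_gt0 n0.
rewrite -(leq_pmul2l k0).
apply: leq_trans (_ : m * n ^ s * F + r ^ s * (m * (\sum_(x in B) d x * wdeg x ^ s)) <= _).
  have -> : m * n ^ s.-1 * (r * P) = m * \sum_(x in B) d x * (n ^ s.-1 * (r * wdeg x)).
    by rewrite -mulnA /P 2!big_distrr /=; congr (m * _); apply: eq_bigr => x _; lia.
  have -> : m * n ^ s * F + r ^ s * (m * (\sum_(x in B) d x * wdeg x ^ s)) =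
     m * \sum_(x in B) d x * (n ^ s + r ^ s * wdeg x ^ s).
    under [in RHS]eq_bigr do rewrite mulnDr mulnCA.
    by rewrite big_split /= -big_distrl -big_distrr /=; lia.
  rewrite leq_mul2l; apply/orP; right; apply: leq_sum => x _.
  by rewrite leq_mul2l split_wdeg orbT.
apply: leq_trans (_ : m * n ^ s * (C * n) + n ^ s.+1 * m <= _).
  apply: leq_add; first by rewrite leq_mul2l FC orbT.
  apply: leq_trans (_ : r ^ s * (n * (C * n) ^ s * (t + s * s)) <= _).
    by rewrite leq_mul2l phi orbT.
  have -> : r ^ s * (n * (C * n) ^ s * (t + s * s)) =
      n ^ s.+1 * (r ^ s * C ^ s * (t + s * s)) by rewrite expnMn expnS; lia.
  by rewrite leq_mul2l rm orbT.
have -> : n ^ s = n * n ^ s.-1 by rewrite -expnS prednK.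
have -> : n ^ s.+1 = n * n * n ^ s.-1 by rewrite -mulnA -!expnS prednK.
by lia.
Qed.

Lemma sum_path3_le :
  \sum_u #|[set v | path3 u v]| <= \sum_(x in B) d x * wdeg x.
Proof.
have one u : #|[set v | path3 u v]| <= \sum_(x in B :&: nbr H u) wdeg x.
  apply: leq_trans (_ : #|\bigcup_(x in B :&: nbr H u)
      \bigcup_(y in B :&: nbr H x) nbr H y| <= _).
    apply/subset_leq_card/subsetP => v; rewrite inE.
    case/exists_inP => x xP /exists_inP[y yP vy].
    by apply/bigcupP; exists x => //; apply/bigcupP; exists y.
  by apply: card_bigcup_le => x _; apply: card_bigcup_le.
apply: (@leq_trans (\sum_u \sum_(x in B :&: nbr H u) wdeg x)).
  by apply: leq_sum => u _; apply: one.
rewrite (exchange_big_dep (mem B)) /=; last by move=> u x _ /setIP[].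
apply: leq_sum => x xB.
rewrite (eq_bigl (mem (nbr H x))) ?sum_nat_const // => u.
by rewrite in_setI xB nbr_sym.
Qed.

End Paths.

(** * Hubs *)

(** Pigeonhole: the [k] increments telescope to at most [M], so not all of them exceed [M / k]. *)
Lemma small_increment (D : nat -> nat) (k M : nat) :
    0 < k -> (forall i, D i <= D i.+1) -> D k <= M ->
  exists2 i, i < k & k * (D i.+1 - D i) <= M.
Proof.
move=> k0 Dmono DM.
have [/existsP[i le_i]|none] := boolP [exists i : 'I_k, k * (D i.+1 - D i) <= M].
  by exists i.
have tele : \sum_(i < k) (D i.+1 - D i) <= M.
  rewrite -(big_mkord xpredT (fun i => D i.+1 - D i)) telescope_sumn_in //.
  by rewrite (leq_trans (leq_subr _ _)).
have : k * M.+1 <= \sum_(i < k) k * (D i.+1 - D i).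
  rewrite -[X in X * _]card_ord -sum_nat_const; apply: leq_sum => i _.
  by rewrite ltnNge; apply: contra none => h; apply/existsP; exists i.
by rewrite -big_distrr /= leq_pmul2l // ltnNge tele.
Qed.

Lemma sum_setU_le (T : finType) (X Y : {set T}) (f : T -> nat) :
  \sum_(x in X :|: Y) f x <= \sum_(x in X) f x + \sum_(x in Y) f x.
Proof.
rewrite (big_setID X) /= setUK leq_add2l (_ : (X :|: Y) :\: X = Y :\: X).
  by rewrite [leqRHS](big_setID X) leq_addl.
by rewrite setDUl setDv set0U.
Qed.

Section Structure.

Variables (T : finType) (H : {set {set T}}).
Hypothesis graphH : H \subset pairs T.

Definition hubs (m : nat) : {set T} := [set x | #|T| <= m * #|nbr H x|].

Lemma card_hubs_le (C m : nat) :
  0 < #|T| -> #|H| <= C * #|T| -> #|hubs m| <= 2 * C * m.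
Proof.
move=> n0 HC; rewrite -(leq_pmul2r n0).
apply: (@leq_trans (m * \sum_(x in hubs m) #|nbr H x|)).
  by rewrite -sum_nat_const big_distrr /=; apply: leq_sum => x; rewrite inE.
have := sum_nbr graphH (hubs m); nia.
Qed.

(** The scales are [1], [psi 1], [psi (psi 1)] and so on. The layers between consecutive hub sets
    are disjoint and have total degree at most [2 * #|H|], so one of the [k] layers carries at most
    a [1 / k] share. *)
Lemma hub_gap (psi : nat -> nat) (C k : nat) :
    (forall m, m <= psi m) -> 0 < k -> #|H| <= C * #|T| ->
  exists2 i, i < k & k * (\sum_(x in hubs (iter i.+1 psi 1) :\: hubs (iter i psi 1))
    #|nbr H x|) <= 2 * C * #|T|.
Proof.
move=> psi_ge k0 HC; pose D i := \sum_(x in hubs (iter i psi 1)) #|nbr H x|.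
have sub i : hubs (iter i psi 1) \subset hubs (iter i.+1 psi 1).
  apply/subsetP => x; rewrite !inE => /leq_trans; apply.
  by rewrite leq_mul2r psi_ge orbT.
have split_D i : D i.+1 = D i +
    \sum_(x in hubs (iter i.+1 psi 1) :\: hubs (iter i psi 1))
    #|nbr H x|.
  rewrite /D (big_setID (hubs (iter i psi 1))) /=; congr (_ + _).
  by apply: eq_bigl => x; rewrite (setIidPr (sub i)).
have [||i ik le_i] := @small_increment D k (2 * C * #|T|) k0.
- by move=> i; rewrite split_D leq_addr.
- by have := sum_nbr graphH (hubs (iter k psi 1)); rewrite -/(D k); nia.
- by exists i => //; rewrite split_D addKn in le_i.
Qed.

(** Every [x] in [X] is a common neighbour of an [s]-subset of [A], and each of these at most
    [2 ^ #|A|] subsets has fewer than [t] of them. So [X] has bounded size, while [m] limits each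
    degree. *)
Lemma sum_multi_hub_le (A X : {set T}) (s t m : nat) :
    (forall Y : {set T}, #|Y| = s -> #|cnbr H Y| < t) ->
    (forall x, x \in X -> s <= #|nbr H x :&: A| /\ m * #|nbr H x| <= #|T|) ->
  m * \sum_(x in X) #|nbr H x| <= 2 ^ #|A| * t * #|T|.
Proof.
move=> free Xm; apply: (@leq_trans (#|X| * #|T|)).
  rewrite big_distrr -sum_nat_const /=; apply: leq_sum => x /Xm[] //.
rewrite leq_mul2r; apply/orP; right.
pose PA := [set Y in powerset A | #|Y| == s].
apply: (@leq_trans #|\bigcup_(Y in PA) cnbr H Y|).
  apply/subset_leq_card/subsetP => x /Xm[sx _].
  have [f [finj fx]] := inj_of_card sx; apply/bigcupP.
  exists [set f i | i : 'I_s]; last first.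
    by rewrite inE; apply/subsetP => y /imsetP[i _ ->]; have /setIP[] := fx i.
  rewrite !inE card_imset // card_ord eqxx andbT.
  by apply/subsetP => y /imsetP[i _ ->]; have /setIP[] := fx i.
apply: (@leq_trans (\sum_(Y in PA) t)).
  by apply: card_bigcup_le => Y; rewrite inE => /andP[_ /eqP/free /ltnW].
rewrite sum_nat_const -card_powerset leq_mul2r; apply/orP; right.
by apply/subset_leq_card/subsetP => Y; rewrite inE => /andP[].
Qed.

End Structure.

(* The second summand makes the vertices with [s] hub neighbours negligible, the
   third one makes 3-edge paths avoiding the hubs rare, both relative to the at
   most [2 * C * m] hubs of scale [m]. *)
Definition gap_step (C k R s t m : nat) : nat :=
  (m + k * t * 2 ^ (2 * C * m) +
   (R * 4 ^ (2 * C * m)) ^ s * (2 * C) ^ s * (t + s * s)).+1.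

(** The gap may occur at any of the [k] scales, so the last one is taken. The value does not depend
    on the graph. *)
Definition hub_bound (C k R s t : nat) : nat :=
  2 * C * iter k (gap_step C k R s t) 1.

(** [Z] gathers the vertices in the gap and those below it with at least [s] hub neighbours. A large
    [k] makes [Z] light and a large [R] makes paths rare. The factor [4 ^ #|A|] is the square of the
    number of possible hub neighbourhoods, by which vertices are classified later. *)
Lemma hub_structure (C k R s t : nat) (T : finType) (H : {set {set T}}) :
    0 < s -> 0 < k -> 0 < #|T| -> H \subset pairs T ->
    (forall Y : {set T}, #|Y| = s -> #|cnbr H Y| < t) -> #|H| <= C * #|T| ->
  exists A Z : {set T},
    [/\ #|A| <= hub_bound C k R s t,
        k * \sum_(x in Z) #|nbr H x| <= (2 * C).+1 * #|T|,
        forall x, x \in Z -> 0 < #|nbr H x|,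
        forall x, x \notin A :|: Z -> #|nbr H x :&: A| < s
      & R * 4 ^ #|A| * \sum_u #|[set v | path3 H (~: (A :|: Z)) u v]| <=
        (2 * C).+1 * #|T| ^ 2].
Proof.
move=> s0 k0 n0 gH free HC.
set psi := gap_step C k R s t.
have psi_ge m : m <= psi m by rewrite /psi /gap_step; lia.
have [i ik gap] := hub_gap gH psi_ge k0 HC.
set m := iter i psi 1 in gap *; set m' := iter i.+1 psi 1 in gap *.
set A := hubs H m in gap *.
have A_le : #|A| <= 2 * C * m by apply: card_hubs_le.
have iter_le j l : j <= l -> iter j psi 1 <= iter l psi 1.
  by elim: l => [|l IHl]; rewrite leq_eqVlt => /predU1P[->|] // /IHl /leq_trans->.
set X := [set x | (x \notin hubs H m') && (s <= #|nbr H x :&: A|)].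
exists A, ((hubs H m' :\: A) :|: X); split.
- apply: leq_trans A_le _; rewrite /hub_bound leq_mul2l iter_le ?orbT //.
  exact: ltnW.
- have X_le : m' * \sum_(x in X) #|nbr H x| <= 2 ^ #|A| * t * #|T|.
    apply: (sum_multi_hub_le free) => x; rewrite !inE -ltnNge => /andP[/ltnW xm' ->].
    by split.
  have m'_ge : k * (2 ^ #|A| * t) <= m'.
    apply: (@leq_trans (k * t * 2 ^ (2 * C * m))).
      by rewrite mulnCA mulnC leq_mul2l leq_pexp2l ?orbT.
    by rewrite /m' iterS -/m /psi /gap_step; lia.
  have k_X : k * \sum_(x in X) #|nbr H x| <= #|T|.
    case: (posnP (2 ^ #|A| * t)) => [e|pos].
      move: X_le; rewrite e mul0n leqn0 muln_eq0 => /orP[|/eqP->]; last by rewrite muln0.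
      by rewrite /m' iterS /psi /gap_step.
    rewrite -(leq_pmul2l pos) mulnA; apply: leq_trans X_le.
    by rewrite leq_mul2r mulnC m'_ge orbT.
  apply: leq_trans (_ : _ <= 2 * C * #|T| + #|T|) _; last by rewrite mulSn addnC.
  apply: leq_trans (leq_add gap k_X).
  by rewrite -mulnDr leq_mul2l sum_setU_le orbT.
- move=> x; rewrite !inE => /orP[/andP[_]|/andP[_ /(leq_trans s0)]].
    by case: #|nbr H x|; rewrite ?muln0 // leqn0 => /eqP e; rewrite e in n0.
  by move=> h; apply: leq_trans h (subset_leq_card (subsetIl _ _)).
- move=> x xAZ; rewrite ltnNge; apply: contra xAZ => sx.
  have : x \in A :|: (hubs H m' :\: A) :|: X.
    by rewrite !inE sx andbT -!orbA; do 2!case: (#|T| <= _).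
  by rewrite setUA.
set B := ~: _.
have r_le : R * 4 ^ #|A| <= R * 4 ^ (2 * C * m).
  by rewrite leq_mul2l leq_pexp2l ?orbT.
have BU x : x \in B -> m' * #|nbr H x| <= #|T|.
  rewrite /B in_setC !in_setU in_setD => xB; apply/ltnW; rewrite ltnNge.
  by apply: contra xB => xh; rewrite [x \in hubs H m']inE xh andbT orbA orbN.
have m'0 : 0 < m' by [].
have FB : \sum_(x in B) #|nbr H x| <= 2 * C * #|T|.
  by have := sum_nbr gH B; nia.
apply: leq_trans (_ : R * 4 ^ #|A| * (\sum_(x in B) #|nbr H x| * wdeg H B x) <= _).
  by rewrite leq_mul2l sum_path3_le // orbT.
apply: (sum_path_le free BU) => //.
apply: leq_trans (_ : _ <= (R * 4 ^ (2 * C * m)) ^ s * (2 * C) ^ s * (t + s * s)) _.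
  by rewrite !leq_mul2r leq_exp2r // r_le !orbT.
by rewrite /m' iterS -/m /psi /gap_step; lia.
Qed.

(** * Saturated subgraphs *)

Section Counting.

Variables (T : finType) (G H : {set {set T}}) (s t : nat) (A Z : {set T}).
Hypotheses (graphG : G \subset pairs T) (satH : saturated (Kst s t) G H).
Hypotheses (s_gt0 : 0 < s) (le_st : s <= t).
Hypothesis few_hubs : forall x, x \notin A :|: Z -> #|nbr H x :&: A| < s.

Local Notation path := (path3 H (~: (A :|: Z))).

Let subHG : H \subset G. Proof. by case/and3P: satH. Qed.
Let freeH : ~~ has_copy (Kst s t) H. Proof. by case/and3P: satH. Qed.
Let graphH : H \subset pairs T. Proof. exact: subset_trans graphG. Qed.

(** Every neighbour of such a vertex is a hub or an admissible inner vertex for [path]. *)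
Definition clean : {set T} :=
  [set u | (u \notin A :|: Z) && [disjoint nbr H u & Z]].

(* [A] is the set of hubs. Under this condition, [uv] creates a copy of [K_(s,t)]
   in which the other [s - 1] vertices on the side of [u] are the hub neighbours
   of [v]. *)
Definition serves u v :=
  (#|nbr H v :&: A| == s.-1) &&
  (t.-1 <= #|nbr H u :&: cnbr H (nbr H v :&: A)|).

Definition self_served : {set T} := [set u in clean | serves u u].

(** Whenever [u] serves [v], the hub neighbourhood of [v] is a member. *)
Definition served u : {set {set T}} :=
  [set Q in powerset A | (#|Q| == s.-1) && (t.-1 <= #|nbr H u :&: cnbr H Q|)].

Lemma path3_sym u v : path u v = path v u.
Proof.
have imp x y : path x y -> path y x.
  case/exists_inP=> a /setIP[aB ax] /exists_inP[b /setIP[bB ba] yb].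
  apply/exists_inP; exists b; first by rewrite in_setI bB nbr_sym.
  apply/exists_inP; exists a; first by rewrite in_setI aB nbr_sym.
  by rewrite nbr_sym.
by apply/idP/idP; apply: imp.
Qed.

(** If [S'] consists of hubs, it is the whole hub neighbourhood of [b], which has at most [s - 1]
    elements, and [a] serves [b]. If both [S'] and [T'] contain non-hubs, these form a path. If only
    [T'] consists of hubs, then [t - 1 <= s - 1] forces [s = t], the sides are interchangeable and
    [b] serves [a]. *)
Lemma serves_of_copy a b (S' T' : {set T}) :
    a \in clean -> b \in clean -> #|S'| = s.-1 -> #|T'| = t.-1 ->
    S' \subset nbr H b -> T' \subset nbr H a -> T' \subset cnbr H S' ->
  [|| path a b, serves a b | serves b a].
Proof.
rewrite !inE => /andP[aAZ aZ] /andP[bAZ bZ] cS cT Sb Ta TS.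
have out x c : [disjoint nbr H c & Z] -> x \in nbr H c -> x \notin A ->
    x \in ~: (A :|: Z).
  by move=> cZ xc xA; rewrite !in_setC in_setU negb_or xA (disjointFr cZ xc).
have TS' x y : x \in T' -> y \in S' -> y \in nbr H x.
  by move=> /(subsetP TS); rewrite inE => /subsetP; apply.
have [SA|/subsetPn[y yS yA]] := boolP (S' \subset A).
  have -> : serves a b; last by rewrite orbT.
  have /eqP e : S' == nbr H b :&: A.
    by rewrite eqEcard subsetI Sb SA cS -ltnS prednK // few_hubs // in_setU.
  by rewrite /serves -e cS eqxx -cT subset_leq_card // subsetI Ta.
have [TA|/subsetPn[x xT xA]] := boolP (T' \subset A); last first.
  apply/orP; left; have xa := subsetP Ta _ xT; have yb := subsetP Sb _ yS.
  apply/exists_inP; exists x; first by rewrite in_setI xa (out _ a).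
  apply/exists_inP; exists y; first by rewrite in_setI TS' // (out _ b).
  by rewrite nbr_sym.
have T_le : T' \subset nbr H a :&: A by rewrite subsetI Ta.
have aA_lt : #|nbr H a :&: A| < s by rewrite few_hubs // in_setU.
have st : s = t.
  apply/eqP; rewrite eqn_leq le_st /=; move: (subset_leq_card T_le) aA_lt.
  by rewrite cT => t_le /(leq_ltn_trans t_le); case: (t).
have /eqP e : T' == nbr H a :&: A.
  by rewrite eqEcard T_le cT -st -ltnS prednK.
have -> : serves b a; last by rewrite !orbT.
rewrite /serves -e cT -st eqxx -cS subset_leq_card // subsetI Sb.
by apply/subsetP => z zS; rewrite inE; apply/subsetP => x xT; rewrite nbr_sym TS'.
Qed.

Lemma clean_pair u v : u \in clean -> v \in clean -> v \in nbr G u ->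
  [|| v \in nbr H u, path u v, serves u v | serves v u].
Proof.
move=> uU vU; rewrite inE => uvG; case: (boolP (v \in nbr H u)) => //= uvH.
have copy : has_copy (Kst s t) ([set u; v] |: H).
  case/and3P: satH => _ _ /forall_inP; apply.
  by rewrite inE uvG andbT; move: uvH; rewrite inE.
have [a [b [S' [T' [ab cS cT Sb [Ta TS]]]]]] := copy_add_edge freeH copy.
case: ab => -[ea eb]; rewrite ea eb in Sb Ta.
  exact: serves_of_copy Sb Ta TS.
rewrite path3_sym [serves u v || _]orbC.
exact: serves_of_copy Sb Ta TS.
Qed.

(** For equal hub neighbourhoods [serves u v] amounts to [serves u u], which fails outside
    [self_served]. So a [G]-edge inside [X] lies in [H] or joins the ends of a path. *)
Lemma class_edges_le (Q : {set T}) (X : {set T}) :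
    {in X, forall u, [&& u \in clean :\: self_served & nbr H u :&: A == Q]} ->
  \sum_(u in X) #|nbr G u :&: X| <= 2 * #|H| + \sum_u #|[set v | path u v]|.
Proof.
move=> XQ; rewrite -(handshake graphH) -big_split /= [leqRHS](bigID (mem X)) /=.
apply/(leq_trans _ (leq_addr _ _))/leq_sum => u uX.
apply: leq_trans (leq_card_setU _ _).
apply/subset_leq_card/subsetP => v /setIP[vG vX].
have /andP[/setDP[uU uN] /eqP uQ] := XQ u uX.
have /andP[/setDP[vU vN] /eqP vQ] := XQ v vX.
have := clean_pair uU vU vG; rewrite /serves uQ vQ.
have : ~~ serves u u by move: uN; rewrite inE uU.
have : ~~ serves v v by move: vN; rewrite inE vU.
rewrite /serves uQ vQ => /negPf-> /negPf->; rewrite !orbF.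
by rewrite in_setU [v \in [set _ | _]]inE.
Qed.

(** The [t - 1] neighbours that witness self-service are not hubs: a hub among them would lie in
    [nbr H u :&: A] and be adjacent to itself. So they add to the [s - 1] hub neighbours. *)
Lemma self_servedP (u : T) : u \in self_served ->
  #|nbr H u :&: A| = s.-1 /\ s.-1 + t.-1 <= #|nbr H u|.
Proof.
rewrite inE => /andP[_ /andP[/eqP cA le_t]]; split=> //.
rewrite -(cardsID A (nbr H u)) cA leq_add2l (leq_trans le_t) //.
apply/subset_leq_card/subsetP => x /setIP[xu xN]; rewrite in_setD xu andbT.
apply/negP => xA; have := nbr_irr graphH x.
by move: xN; rewrite inE => /subsetP->; rewrite // in_setI xu.
Qed.

Lemma self_served_notin_hubs u : u \in self_served -> u \notin A.
Proof. by rewrite !inE negb_or => /andP[/andP[/andP[]]]. Qed.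

(** Each self-served vertex has degree at least [(s - 1) + (t - 1)], and its [s - 1] edges to hubs
    are counted once more in the degrees of the hubs. *)
Lemma edges_ge_degree : #|self_served| * (2 * s + t - 3) <= 2 * #|H|.
Proof.
apply: (@leq_trans (\sum_(u in self_served) #|nbr H u :&: A| +
                    \sum_(u in self_served) #|nbr H u|)).
  rewrite -big_split -sum_nat_const /=; apply: leq_sum => u /self_servedP[-> d_ge].
  by apply: leq_trans (leq_add (leqnn _) d_ge); move: s_gt0; clear; lia.
rewrite -(handshake graphH) [leqRHS](bigID (mem A)) /=; apply: leq_add.
  have -> : \sum_(u in self_served) #|nbr H u :&: A| =
      \sum_(u in self_served) \sum_(x in A | x \in nbr H u) 1.
    apply: eq_bigr => u _; rewrite sum1dep_card; apply: eq_card => x.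
    by rewrite !inE andbC.
  rewrite (exchange_big_dep (mem A)) /=; last by move=> u x _ /andP[].
  apply: leq_sum => x xA; rewrite sum1dep_card.
  apply/subset_leq_card/subsetP => u; rewrite inE => /and3P[_ _].
  by rewrite nbr_sym.
rewrite [leqRHS](bigID (mem self_served)) /= -[leqLHS]addn0 leq_add // leq_eqVlt.
apply/orP; left; apply/eqP/eq_bigl => u /=.
by have [/self_served_notin_hubs->|] := boolP (u \in self_served); rewrite ?andbF.
Qed.

(* A non-hub has at most [s - 1] hub neighbours, so it is a common neighbour of at
   most one [(s - 1)]-set of hubs. *)
Lemma degree_ge_served u :
  u \in self_served -> s.-1 + (t - s) * #|served u| <= #|nbr H u|.
Proof.
move=> uS; have [dA _] := self_servedP uS.
have uU : u \in clean by move: uS; rewrite inE => /andP[].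
rewrite -(cardsID A (nbr H u)) dA leq_add2l.
pose E Q := [set x in nbr H u :\: A | nbr H x :&: A == Q].
have E_ge Q : Q \in served u -> t - s <= #|E Q|.
  rewrite !inE => /and3P[QA /eqP cQ le_t].
  have sub : (nbr H u :&: cnbr H Q) :\: A \subset E Q.
    apply/subsetP => x; rewrite in_setD in_setI => /and3P[xA xu].
    rewrite inE => Qx; rewrite in_set in_setD xA xu /= eq_sym eqEcard subsetI Qx QA cQ /=.
    rewrite -ltnS prednK // few_hubs // in_setU negb_or xA /=.
    by move: uU; rewrite inE => /andP[_ /disjointFr->].
  apply: leq_trans (subset_leq_card sub).
  have := cardsID A (nbr H u :&: cnbr H Q).
  have : #|nbr H u :&: cnbr H Q :&: A| <= s.-1.
    by rewrite -dA subset_leq_card // setSI // subsetIl.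
  by move: le_t s_gt0; clear; lia.
rewrite mulnC -sum_nat_const.
apply: (@leq_trans (\sum_(Q in served u) #|E Q|)); first exact: leq_sum.
have -> : #|nbr H u :\: A| = \sum_(x in nbr H u :\: A) 1 by rewrite sum1_card.
rewrite (partition_big (fun x => nbr H x :&: A) predT) //=.
rewrite [leqRHS](bigID (mem (served u))) /= -[leqLHS]addn0 leq_add //.
by apply: leq_sum => Q _; rewrite sum1dep_card.
Qed.

Lemma edges_ge_served :
  #|self_served| * s.-1 + (t - s) * \sum_(u in self_served) #|served u| <= 2 * #|H|.
Proof.
rewrite big_distrr /= -sum_nat_const -big_split /=.
apply: leq_trans (sum_nbr graphH self_served).
by apply: leq_sum => u; apply: degree_ge_served.
Qed.

(** A [G]-edge inside the set lies in [H], joins the ends of a path, or comes from service in one of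
    two directions. The vertices that [u] serves through [Q] are common [G]-neighbours of the
    [s]-set [u |: Q], so there are at most [K] of them. *)
Lemma self_served_pairs_le (K : nat) :
    (forall Q : {set T}, #|Q| = s -> #|cnbr G Q| <= K) ->
  \sum_(u in self_served) #|nbr G u :&: self_served| <=
  2 * #|H| + \sum_u #|[set v | path u v]| + 2 * (K * \sum_(u in self_served) #|served u|).
Proof.
move=> codeg; set X := self_served.
pose Sv u := [set v in X :&: nbr G u | serves u v].
have Sv_le u : u \in X -> #|Sv u| <= K * #|served u|.
  move=> uX; have uA := self_served_notin_hubs uX.
  have -> : K * #|served u| = \sum_(Q in served u) K by rewrite sum_nat_const mulnC.
  apply: leq_trans (_ : #|\bigcup_(Q in served u) cnbr G (u |: Q)| <= _).
    apply/subset_leq_card/subsetP => v.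
    rewrite inE in_setI => /andP[/andP[vX vu] /andP[cv le_t]].
    apply/bigcupP; exists (nbr H v :&: A); first by rewrite !inE subsetIr cv.
    rewrite inE subUset sub1set nbr_sym vu /=; apply: subset_trans (subsetIl _ _) _.
    by apply/subsetP => x; rewrite !inE => /(subsetP subHG).
  apply: card_bigcup_le => Q; rewrite !inE => /and3P[QA /eqP cQ _].
  apply: codeg; rewrite cardsU1 cQ; case: (boolP (u \in Q)) => [/(subsetP QA)|_].
    by rewrite (negPf uA).
  by rewrite add1n prednK.
have sum_Sv : \sum_(u in X) #|Sv u| <= K * \sum_(u in X) #|served u|.
  by rewrite big_distrr; apply: leq_sum.
have sum_Sv' : \sum_(u in X) #|[set v in X :&: nbr G u | serves v u]| <=
    K * \sum_(u in X) #|served u|.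
  apply: leq_trans sum_Sv; rewrite leq_eqVlt; apply/orP; left; apply/eqP.
  have expand (Y : {set T}) (f : T -> T -> bool) : (forall u v, f u v -> v \in Y) ->
     \sum_(u in Y) #|[set v | f u v]| = \sum_(u in Y) \sum_(v in Y | f u v) 1.
    move=> fX; apply: eq_bigr => u _; rewrite sum1dep_card; apply: eq_card => v.
    by rewrite !in_set; case: (boolP (f u v)) => [/fX->|]; rewrite ?andbF.
  rewrite /Sv !expand; first last.
  - by move=> u v; rewrite in_setI => /andP[/andP[]].
  - by move=> u v; rewrite in_setI => /andP[/andP[]].
  rewrite (exchange_big_dep (mem X)) /=; last by move=> u v _ /andP[].
  apply: eq_bigr => v vX; apply: eq_bigl => u.
  by rewrite !in_setI vX nbr_sym; do !case: (_ \in _).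
rewrite -(handshake graphH) [2 * (K * _)]mul2n -addnn.
apply: leq_trans (leq_add (leqnn _) (leq_add sum_Sv sum_Sv')).
rewrite -2!big_split /= [X in _ <= X + _](bigID (mem X)) /=.
rewrite addnAC; apply: leq_trans (leq_addr _ _); rewrite -big_split /=.
apply: leq_sum => u uX.
apply: (@leq_trans #|(nbr H u :|: [set v | path u v]) :|:
   (Sv u :|: [set v in X :&: nbr G u | serves v u])|).
  apply/subset_leq_card/subsetP => v /setIP[vG vX].
  have [uU vU] : u \in clean /\ v \in clean.
    by move: uX vX; rewrite !inE => /andP[-> _] /andP[-> _].
  case/or4P: (clean_pair uU vU vG) => h; apply/setUP.
  - by left; apply/setUP; left.
  - by left; apply/setUP; right; rewrite in_set.
  - by right; apply/setUP; left; rewrite /Sv in_set in_setI vX vG.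
  - by right; apply/setUP; right; rewrite in_set in_setI vX vG.
apply: leq_trans (leq_card_setU _ _) _; apply: leq_add; exact: leq_card_setU.
Qed.

(** As [Z] has no isolated vertex, its degree sum bounds both [Z] and the neighbourhood of [Z];
    hence the factor 2. *)
Lemma card_unclean_le :
    (forall x, x \in Z -> 0 < #|nbr H x|) ->
  #|~: clean| <= #|A| + 2 * \sum_(x in Z) #|nbr H x|.
Proof.
move=> Z0; pose NZ := \bigcup_(x in Z) nbr H x.
apply: (@leq_trans #|A :|: (Z :|: NZ)|).
  apply/subset_leq_card/subsetP => u; rewrite !inE negb_and negbK.
  case/orP=> [/orP[]->|]; rewrite ?orbT //.
  rewrite -setI_eq0 => /set0Pn[x /setIP[xu xZ]].
  by apply/or3P/Or33/bigcupP; exists x; rewrite // nbr_sym.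
apply: leq_trans (leq_card_setU _ _) _; rewrite leq_add2l.
apply: leq_trans (leq_card_setU _ _) _; rewrite mul2n -addnn; apply: leq_add.
  by rewrite -sum1_card; apply: leq_sum.
exact: card_bigcup_le.
Qed.

End Counting.

(** * Lower bound for pseudorandom host graphs *)

Local Open Scope ring_scope.

(** The sum counts each edge inside [X] twice, so in the random graph it is about [p * #|X| ^ 2]. *)
Definition dense (R : realType) (T : finType) (p eta : R) (G : {set {set T}}) :=
  forall X : {set T}, eta * #|T|%:R <= #|X|%:R ->
  (p - eta) * #|X|%:R ^+ 2 <= (\sum_(u in X) #|nbr G u :&: X|)%:R.

Definition small_codegree (R : realType) (T : finType) (s : nat) (p eta : R)
    (G : {set {set T}}) :=
  forall Q : {set T}, #|Q| = s -> #|cnbr G Q|%:R <= (p ^+ s + eta) * #|T|%:R.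

(** Split the clean vertices that do not serve themselves by hub neighbourhood. A class larger than
    [n / (k * 2 ^ #|A|)] would span more edges of [G] than [class_edges_le] allows. *)
Lemma small_classes (R : realType) (p eta : R) (T : finType)
    (G H : {set {set T}}) (s t : nat) (A Z : {set T}) (C k r : nat) :
    G \subset pairs T -> saturated (Kst s t) G H -> (0 < s <= t)%N ->
    (forall x, x \notin A :|: Z -> #|nbr H x :&: A| < s)%N ->
    dense p eta G ->
    0 < p -> 0 <= eta -> eta <= p / 2 -> eta * (k * 2 ^ #|A|)%:R <= 1 ->
    (0 < #|T|)%N -> (#|H| <= C * #|T|)%N ->
    (r * 4 ^ #|A| * \sum_u #|[set v | path3 H (~: (A :|: Z)) u v]| <=
      (2 * C).+1 * #|T| ^ 2)%N ->
    (k ^ 2 * (2 * C).+1)%:R <= p / 8 * r%:R ->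
    (2 * C * k ^ 2 * 4 ^ #|A|)%:R <= p / 8 * #|T|%:R ->
  (k * #|clean H A Z :\: self_served H s t A Z| <= #|T|)%N.
Proof.
move=> gG satH /andP[s0 st] few dns p0 eta0 etap etak n0 HC pathC rk nk.
set n := #|T|; set a := #|A|; set Y := clean H A Z :\: _.
pose X Q := [set u in Y | nbr H u :&: A == Q].
have XQ Q : (k * 2 ^ a * #|X Q| <= n)%N.
  rewrite leqNgt; apply/negP => lt_n.
  have class : {in X Q, forall u, [&& u \in Y & nbr H u :&: A == Q]}.
    by move=> u; rewrite in_set.
  have le_sum := class_edges_le gG satH s0 st few class.
  set S := (\sum_(u in X Q) _)%N in le_sum; set P := (\sum_u _)%N in le_sum pathC.
  set x := #|X Q| in lt_n *; set K := (k * 2 ^ a)%N in lt_n etak.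
  have lt_nR : n%:R < K%:R * x%:R :> R by rewrite -natrM ltr_nat.
  have n0R : 0 < n%:R :> R by rewrite ltr0n.
  have x0R : 0 <= x%:R :> R by [].
  have le_eta : eta * n%:R <= x%:R.
    apply: (@le_trans _ _ (eta * (K%:R * x%:R))); first by rewrite ler_wpM2l // ltW.
    by rewrite mulrA ler_piMl.
  have k0 : (0 < k)%N by rewrite lt0n; apply/eqP => k0; move: lt_n; rewrite /K k0 !mul0n ltn0.
  have r0 : 0 < r%:R :> R.
    rewrite -(pmulr_rgt0 (r%:R) (_ : 0 < p / 8)); last by lra.
    by apply: lt_le_trans rk; rewrite ltr0n muln_gt0 expn_gt0 k0.
  have K2 : (K ^ 2 = k ^ 2 * 4 ^ a)%N by rewrite /K expnMn -expnM [(a * 2)%N]mulnC expnM.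
  (* Scaled by [K ^ 2] and in units of [n ^ 2], edges of [H] and paths account for [p / 8] each,
     whereas density of a large class demands more than [p / 2]. *)
  have hS : (K ^ 2 * S)%:R <= p / 4 * n%:R ^+ 2.
    apply: (@le_trans _ _ ((K ^ 2 * (2 * #|H|))%:R + (K ^ 2 * P)%:R)).
      by rewrite -natrD -mulnDr ler_nat leq_mul2l le_sum orbT.
    have H_le : (K ^ 2 * (2 * #|H|))%:R <= p / 8 * n%:R ^+ 2.
      apply: (@le_trans _ _ ((2 * C * k ^ 2 * 4 ^ a)%:R * n%:R)).
        rewrite -natrM ler_nat K2.
        have -> : (2 * C * k ^ 2 * 4 ^ a * n = k ^ 2 * 4 ^ a * (2 * (C * n)))%N by clear; lia.
        by rewrite !leq_mul2l HC !orbT.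
      by rewrite expr2 mulrA ler_pM2r.
    have P_le : (K ^ 2 * P)%:R <= p / 8 * n%:R ^+ 2.
      rewrite -(ler_pM2l r0) -natrM.
      apply: (@le_trans _ _ ((k ^ 2 * (2 * C).+1)%:R * n%:R ^+ 2)); last first.
        rewrite [leRHS](_ : _ = p / 8 * r%:R * n%:R ^+ 2); last by ring.
        by rewrite ler_wpM2r // exprn_ge0.
      rewrite -natrX -natrM ler_nat K2.
      have -> : (r * (k ^ 2 * 4 ^ a * P) = k ^ 2 * (r * 4 ^ a * P))%N by clear; lia.
      by rewrite -[leqRHS]mulnA leq_mul2l pathC orbT.
    by lra.
  have := dns _ le_eta; rewrite -/S -/x => dS.
  have : K%:R ^+ 2 * (p / 2 * x%:R ^+ 2) <= p / 4 * n%:R ^+ 2.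
    apply: le_trans hS; rewrite natrM natrX ler_wpM2l ?exprn_ge0 //.
    by apply: le_trans dS; rewrite ler_wpM2r ?exprn_ge0 //; lra.
  have : n%:R ^+ 2 < (K%:R * x%:R) ^+ 2 :> R by rewrite ltrXn2r // ?ler0n ?mulr_ge0.
  have : 0 < n%:R ^+ 2 :> R by rewrite exprn_gt0.
  rewrite exprMn; move: (K%:R ^+ 2) (x%:R ^+ 2) (n%:R ^+ 2) => K' x' n' n'0 ltn.
  have -> : K' * (p / 2 * x') = p / 2 * (K' * x') by ring.
  move: (K' * x') ltn => y ltn h; have : p * n' < p * y by rewrite ltr_pM2l.
  have : 0 < p * n' by rewrite mulr_gt0.
  by lra.
have Y_le : (#|Y| = \sum_(Q in powerset A) #|X Q|)%N.
  rewrite -sum1_card (partition_big (fun u => nbr H u :&: A) (mem (powerset A))) /=.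
    by apply: eq_bigr => Q _; rewrite sum1dep_card; apply: eq_card => u; rewrite !in_set.
  by move=> u _; rewrite powersetE subsetIr.
have a0 : (0 < 2 ^ a)%N by rewrite expn_gt0.
rewrite -(leq_pmul2l a0) mulnA [(2 ^ a * k)%N]mulnC Y_le big_distrr /=.
apply: (@leq_trans (\sum_(Q in powerset A) n)%N); first by apply: leq_sum => Q _; apply: XQ.
by rewrite sum_nat_const card_powerset.
Qed.

Lemma exists_natR_ge (R : realType) (x : R) : exists n : nat, x <= n%:R.
Proof.
by exists (Num.truncn x).+1; exact/ltW/Num.Theory.truncnS_gt.
Qed.

(** [x] is the number of self-served vertices and [r] the total number of hub sets they serve. In
    the proof [k] and the path parameter are chosen first; they fix the hub bound [a0], on which
    [eta] and [n0] depend. *)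
Lemma saturation_counts (R : realType) (p alpha : R) (s t C : nat) :
    0 < p -> (0 < s <= t)%N -> 0 < alpha -> alpha <= 1 / 2 ->
  exists (eta : R) (n0 : nat), 0 < eta /\
  forall (T : finType) (G H : {set {set T}}),
    (n0 <= #|T|)%N -> G \subset pairs T -> dense p eta G ->
    small_codegree s p eta G -> saturated (Kst s t) G H ->
    (#|H| <= C * #|T|)%N ->
  exists x r : nat,
    [/\ (1 - alpha) * #|T|%:R <= x%:R,
        (x * (2 * s + t - 3) <= 2 * #|H|)%N,
        (x * s.-1 + (t - s) * r <= 2 * #|H|)%N
      & (p - alpha) * x%:R ^+ 2 <=
        alpha * #|T|%:R ^+ 2 + 2 * (p ^+ s + alpha) * #|T|%:R * r%:R].
Proof.
move=> p0 st alpha0 alpha1; have /andP[s0 le_st] := st.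
pose D := (2 * C).+1.
(* In units of [n / k], the hubs and [Y] cost 1 each, and [Z] with its neighbours [2 * D]. *)
have [k k_ge] := exists_natR_ge ((2 * D + 2)%:R / alpha).
rewrite ler_pdivrMr // in k_ge.
have k0 : (0 < k)%N.
  by rewrite -(ltr0n R) -(pmulr_lgt0 _ alpha0); apply: lt_le_trans k_ge; rewrite ltr0n addn2.
(* The first summand keeps paths below [alpha / 2 * n ^ 2] in the final count; the second is for
   [small_classes]. *)
have [r r_ge] := exists_natR_ge (D%:R / (alpha / 2) + (k ^ 2 * D)%:R / (p / 8)).
pose a0 := hub_bound C k r s t.
have [n1 n1_ge] := exists_natR_ge
  ((2 * C)%:R / (alpha / 2) + (2 * C * k ^ 2 * 4 ^ a0)%:R / (p / 8)).
have K0 : 0 < (k * 2 ^ a0)%:R :> R by rewrite ltr0n muln_gt0 k0 expn_gt0.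
have [r1 r2] : D%:R <= alpha / 2 * r%:R /\ (k ^ 2 * D)%:R <= p / 8 * r%:R.
  have h1 : 0 <= D%:R / (alpha / 2) by rewrite divr_ge0 //; lra.
  have h2 : 0 <= (k ^ 2 * D)%:R / (p / 8) by rewrite divr_ge0 //; lra.
  by split; rewrite mulrC -ler_pdivrMr; lra.
exists (Num.min (Num.min alpha (p / 2)) (k * 2 ^ a0)%:R^-1), (k * a0 + n1).+1.
set eta := Num.min _ _.
have [e1 e2 e3] : [/\ eta <= alpha, eta <= p / 2 & eta <= (k * 2 ^ a0)%:R^-1].
  by rewrite /eta !ge_min !lexx !orbT.
have eta0 : 0 < eta by rewrite !lt_min alpha0 invr_gt0 K0 andbT /=; lra.
split=> // T G H n0 gG dns codeg satH HC; set n := #|T| in n0 HC *.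
have n_gt0 : (0 < n)%N by apply: leq_trans n0.
have n0R : 0 < n%:R :> R by rewrite ltr0n.
have [n2 n3] : (2 * C)%:R <= alpha / 2 * n%:R /\ (2 * C * k ^ 2 * 4 ^ a0)%:R <= p / 8 * n%:R.
  have h1 : 0 <= (2 * C)%:R / (alpha / 2) by rewrite divr_ge0 //; lra.
  have h2 : 0 <= (2 * C * k ^ 2 * 4 ^ a0)%:R / (p / 8) by rewrite divr_ge0 //; lra.
  have : n1%:R <= n%:R :> R by rewrite ler_nat; apply: leq_trans n0; rewrite leqW // leq_addl.
  by split; rewrite mulrC -ler_pdivrMr; lra.
have gH : H \subset pairs T by case/and3P: satH => /subset_trans->.
have free (Y : {set T}) : (#|Y| = s -> #|cnbr H Y| < t)%N.
  by apply: free_cnbr => //; case/and3P: satH.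
have [A [Z [A_le Z_le Z_pos few pathC]]] := hub_structure r s0 k0 n_gt0 gH free HC.
set P := (\sum_u _)%N in pathC.
set S := self_served H s t A Z; pose Y := clean H A Z :\: S.
have Y_le : (k * #|Y| <= n)%N.
  apply: (@small_classes R p eta _ G H s t A Z C k r) => //; first exact: ltW.
    apply: le_trans (_ : eta * (k * 2 ^ a0)%:R <= _); last by rewrite -ler_pdivlMr // mul1r.
    by rewrite ler_wpM2l ?(ltW eta0) // ler_nat leq_mul2l leq_pexp2l ?orbT.
  apply: le_trans n3; rewrite ler_nat leq_mul2l leq_pexp2l ?orbT //.
have S_ge : (1 - alpha) * n%:R <= #|S|%:R.
  have := card_unclean_le A Z_pos.
  have cS : (n <= #|S| + (#|~: clean H A Z| + #|Y|))%N.
    rewrite -[n](cardsC S) leq_add2l.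
    apply: leq_trans (leq_card_setU _ _); apply/subset_leq_card/subsetP => u.
    by rewrite in_setC in_setU in_setC in_setD => ->; rewrite orNb.
  move=> U_le.
  have : (k * n <= k * #|S| + (2 * D + 2) * n)%N.
    apply: leq_trans (_ : k * (#|S| + (#|~: clean H A Z| + #|Y|)) <= _)%N.
      by rewrite leq_mul2l cS orbT.
    have : (k * #|A| <= n)%N.
      apply: leq_trans (ltnW n0); rewrite (leq_trans _ (leq_addr _ _)) //.
      by rewrite leq_mul2l A_le orbT.
    have : (k * #|~: clean H A Z| <= k * #|A| + 2 * (D * n))%N.
      apply: leq_trans (_ : k * (#|A| + 2 * \sum_(x in Z) #|nbr H x|) <= _)%N.
        by rewrite leq_mul2l U_le orbT.
      by rewrite mulnDr leq_add2l mulnCA leq_mul2l Z_le.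
    by move: Y_le; clear; lia.
  rewrite -(ler_nat R) natrD !natrM => h.
  have k0R : 0 < k%:R :> R by rewrite ltr0n.
  rewrite -(ler_pM2l k0R).
  have : (2 * D + 2)%:R * n%:R <= k%:R * alpha * n%:R by rewrite ler_pM2r.
  by lra.
exists #|S|, (\sum_(u in S) #|served H s t A u|)%N; split=> //.
- exact: edges_ge_degree gG satH s0.
- exact: edges_ge_served gG satH s0 few.
pose K := Num.truncn ((p ^+ s + eta) * n%:R).
have pe0 : 0 <= (p ^+ s + eta) * n%:R.
  by rewrite mulr_ge0 // addr_ge0 ?exprn_ge0 // ltW.
have cK (Q : {set T}) : (#|Q| = s -> #|cnbr G Q| <= K)%N.
  by move=> cQ; rewrite truncn_ge_nat //; apply: codeg.
have pairs_le := self_served_pairs_le gG satH s0 le_st few cK.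
rewrite -/S -/P in pairs_le; set rr := (\sum_(u in S) #|served H s t A u|)%N in pairs_le *.
have eS : eta * n%:R <= #|S|%:R.
  by apply: le_trans S_ge; rewrite ler_pM2r //; lra.
apply: (@le_trans _ _ ((p - eta) * #|S|%:R ^+ 2)).
  by rewrite ler_wpM2r ?exprn_ge0 //; lra.
apply: le_trans (dns _ eS) _.
apply: (@le_trans _ _ (2 * #|H| + P + 2 * (K * rr))%:R); first by rewrite ler_nat.
rewrite !natrD -addrA; set N2 := n%:R ^+ 2.
have H_le : (2 * #|H|)%:R <= alpha / 2 * N2.
  apply: (@le_trans _ _ ((2 * C)%:R * n%:R)); first by rewrite -natrM ler_nat -mulnA leq_mul2l HC.
  by rewrite /N2 expr2 mulrA ler_pM2r.
have r0 : 0 < r%:R :> R.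
  by rewrite -(pmulr_rgt0 _ (_ : 0 < alpha / 2)); [apply: lt_le_trans r1|lra].
have P_le : P%:R <= alpha / 2 * N2.
  rewrite -(ler_pM2l r0); apply: (@le_trans _ _ (D%:R * N2)); last first.
    rewrite [leRHS](_ : _ = alpha / 2 * r%:R * N2); last by ring.
    by rewrite ler_wpM2r // exprn_ge0.
  rewrite /N2 -natrX -!natrM ler_nat; apply: leq_trans pathC.
  by rewrite leq_mul2r leq_pmulr ?orbT // expn_gt0.
have K_le : (2 * (K * rr))%:R <= 2 * (p ^+ s + alpha) * n%:R * rr%:R.
  rewrite !natrM -!mulrA ler_pM2l // !mulrA ler_wpM2r //.
  apply: (@le_trans _ _ ((p ^+ s + eta) * n%:R)); first by rewrite truncn_le.
  by rewrite ler_wpM2r // lerD2l.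
by lra.
Qed.

Definition sat_const (R : realType) (p : R) (s t : nat) : R :=
  Num.max ((2 * s%:R + t%:R - 3) / 2)
          ((t%:R - s%:R) / (4 * p ^+ (s - 1)) + (s%:R - 1) / 2).

Lemma sat_ge (R : realType) (p eps : R) (s t : nat) :
    0 < p < 1 -> (2 <= s)%N -> (s <= t)%N -> 0 < eps ->
  exists (eta : R) (n0 : nat), 0 < eta /\
  forall (T : finType) (G : {set {set T}}),
    (n0 <= #|T|)%N -> G \subset pairs T -> dense p eta G ->
    small_codegree s p eta G ->
  (sat_const p s t - eps) * #|T|%:R <= (sat G (Kst s t))%:R.
Proof.
move=> /andP[p0 p1] s2 st eps0.
have s0 : (0 < s)%N by apply: leq_trans s2.
pose q := p ^+ (s - 1); have q0 : 0 < q by rewrite exprn_gt0.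
have q1 : q <= 1 by rewrite exprn_ile1 // ltW.
have pq : p ^+ s = p * q by rewrite -exprS subn1 prednK.
have sR : 2 <= s%:R :> R by rewrite ler_nat.
have stR : s%:R <= t%:R :> R by rewrite ler_nat.
pose w := (t%:R - s%:R) / q.
have w0 : 0 <= w by rewrite divr_ge0 ?subr_ge0 // ltW.
(* [B * b * n] covers the loss in either term of the maximum; [5 / 4 * w] is the relative loss
   [5 * b] of [r_ge3] on [w / 4]. *)
pose B := 2 * s%:R + t%:R + 5 / 4 * w.
have B0 : 0 < B by rewrite /B; lra.
pose b := Num.min (1 / 2) (eps / B).
have b0 : 0 < b by rewrite lt_min !divr_gt0.
have b1 : b <= 1 / 2 by rewrite ge_min lexx.
have bB : b * B <= eps by rewrite -ler_pdivlMr // ge_min lexx orbT.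
(* This makes [p ^+ s + alpha] equal to [p * q * (1 + b)], a relative error of [b]. *)
pose alpha := b * (p * q).
have alpha0 : 0 < alpha by rewrite !mulr_gt0.
have pq1 : p * q <= 1 by rewrite mulr_ile1 // ltW.
have ab : alpha <= b by rewrite ler_piMr // ltW.
have a_half : alpha <= 1 / 2 by apply: le_trans b1.
(* The argument is by contradiction, so [H] will have at most [C * n] edges. *)
have [C C_ge] := exists_natR_ge (sat_const p s t).
have s0t : (0 < s <= t)%N by rewrite s0.
have [eta [n0 [eta0 counts]]] :=
  @saturation_counts R p alpha s t C p0 s0t alpha0 a_half.
exists eta, n0.+1; split=> // T G nT gG dns codeg.
have Kst0 : Kst s t != set0.
  apply/set0Pn; exists [set inl (Ordinal s0); inr (Ordinal (leq_trans s0 st))].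
  exact: imset2_f.
have [H satH <-] := sat_attained G Kst0.
rewrite leNgt; apply/negP => H_lt; set n := (#|T|%:R : R) in H_lt *.
have n_gt0 : 0 < n by rewrite ltr0n; apply: leq_trans nT.
have HC : (#|H| <= C * #|T|)%N.
  rewrite -(ler_nat R) natrM; apply/ltW/(lt_le_trans H_lt).
  by rewrite ler_wpM2r // ?ltW //; lra.
have [x [r [x_ge deg_le srv_le pairs_le]]] := counts T G H (ltnW nT) gG dns codeg satH HC.
rewrite -/n in x_ge pairs_le.
have an : alpha * n <= b * n by rewrite ler_pM2r.
have deg_leR : x%:R * (2 * s%:R + t%:R - 3) <= 2 * #|H|%:R :> R.
  have s3 : (3 <= 2 * s + t)%N by move: s2 st; clear; lia.
  by move: deg_le; rewrite -(ler_nat R) !natrM natrB // natrD natrM.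
have srv_leR : x%:R * (s%:R - 1) + (t%:R - s%:R) * r%:R <= 2 * #|H|%:R :> R.
  by move: srv_le; rewrite -(ler_nat R) natrD !natrM natrB // -subn1 natrB.
have bBn : b * B * n <= eps * n by rewrite ler_pM2r.
have en : 0 < eps * n by rewrite mulr_gt0.
move: H_lt; apply/negP; rewrite -leNgt mulrBl lerBlDr /sat_const.
rewrite (maxr_pMl _ _ (ltW n_gt0)) ge_max; apply/andP; split.
  have h : (1 - alpha) * n * (2 * s%:R + t%:R - 3) <= x%:R * (2 * s%:R + t%:R - 3).
    by rewrite ler_wpM2r //; lra.
  have h2 : alpha * n * (2 * s%:R + t%:R - 3) <= b * n * (2 * s%:R + t%:R - 3).
    by rewrite ler_wpM2r //; lra.
  have : b * n * (2 * s%:R + t%:R - 3) <= b * n * B.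
    by rewrite ler_pM2l ?mulr_gt0 // /B; lra.
  by lra.
have x_sq : (1 - 2 * alpha) * n ^+ 2 <= x%:R ^+ 2.
  apply: (@le_trans _ _ (((1 - alpha) * n) ^+ 2)).
    rewrite exprMn ler_pM2r ?exprn_gt0 //.
    by have := sqr_ge0 alpha; lra.
  by rewrite ler_pXn2r ?nnegrE //; rewrite mulr_ge0 ?ltW //; lra.
have pa : 0 < p - alpha.
  have : alpha <= p / 2.
    apply: (@le_trans _ _ (1 / 2 * p)); last by lra.
    by rewrite ler_pM ?(ltW b0) ?mulr_ge0 ?(ltW p0) ?(ltW q0) // ler_piMr // ltW.
  by lra.
have r_ge1 : (p - 4 * alpha) * n <= 2 * (p * q) * (1 + b) * r%:R.
  rewrite -(ler_pM2r n_gt0).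
  have h : (p - alpha) * ((1 - 2 * alpha) * n ^+ 2) <= (p - alpha) * x%:R ^+ 2.
    by rewrite ler_pM2l.
  have ap : alpha * p * n ^+ 2 <= alpha * n ^+ 2.
    by rewrite ler_pM2r ?exprn_gt0 // ler_piMr ?(ltW alpha0) ?(ltW p1).
  have aa : 0 <= alpha ^+ 2 * n ^+ 2 by rewrite mulr_ge0 ?sqr_ge0.
  have -> : 2 * (p * q) * (1 + b) * r%:R * n = 2 * (p ^+ s + alpha) * n * r%:R.
    by rewrite pq /alpha; ring.
  by move: h pairs_le ap aa; clear; nra.
have r_ge2 : (1 - 4 * b) * n <= 2 * q * (1 + b) * r%:R.
  rewrite -(ler_pM2l p0); apply: (@le_trans _ _ ((p - 4 * alpha) * n)); last first.
    by apply: le_trans r_ge1 _; rewrite le_eqVlt; apply/orP; left; apply/eqP; ring.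
  rewrite mulrA ler_pM2r // /alpha.
  have : b * (p * q) <= b * p by rewrite ler_pM2l // ler_piMr // ltW.
  by lra.
(* This uses [(1 - 5 * b) * (1 + b) <= 1 - 4 * b]. *)
have r_ge3 : (1 - 5 * b) * n <= 2 * q * r%:R.
  have b10 : 0 < 1 + b by lra.
  rewrite -(ler_pM2l b10).
  have : 0 <= b ^+ 2 * n by rewrite mulr_ge0 ?sqr_ge0 // ltW.
  by lra.
have r_ge : (1 - 5 * b) * n * w <= 2 * ((t%:R - s%:R) * r%:R).
  have -> : 2 * ((t%:R - s%:R) * r%:R) = 2 * q * r%:R * w.
    by rewrite /w; field; rewrite gt_eqF.
  by rewrite ler_wpM2r.
have h1 : (1 - alpha) * n * (s%:R - 1) <= x%:R * (s%:R - 1).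
  by rewrite ler_wpM2r //; lra.
have h2 : alpha * n * (s%:R - 1) <= b * n * (s%:R - 1).
  by rewrite ler_wpM2r //; lra.
have h3 : b * n * (s%:R + 5 / 4 * w) <= b * n * B.
  by rewrite ler_pM2l ?mulr_gt0 // /B; lra.
have h4 : 0 <= b * n by rewrite mulr_ge0 ?ltW.
rewrite -/q (_ : (t%:R - s%:R) / (4 * q) = w / 4); last first.
  by rewrite /w; field; rewrite gt_eqF.
have h5 : 0 <= b * n * s%:R by rewrite mulr_ge0.
by move: h1 h2 h3 h4 h5 r_ge srv_leR bBn; clear; lra.
Qed.

(** * The random graph *)

Section Gnp.

Variables (R : realType) (p : R) (n : nat).
Hypothesis p01 : 0 < p < 1.

Let p_ge0 : 0 <= p. Proof. by case/andP: p01 => /ltW. Qed.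
Let p_le1 : p <= 1. Proof. by case/andP: p01 => _ /ltW. Qed.

Lemma gnp_weight_ge0 (G : {set {set 'I_n}}) : 0 <= gnp_weight p G.
Proof. by apply: prodr_ge0 => e _; case: ifP; rewrite ?subr_ge0. Qed.

Lemma gnp_prob_markov (A : pred {set {set 'I_n}}) (f : {set {set 'I_n}} -> R) :
    (forall G, 0 <= f G) ->
    (forall G : {set {set 'I_n}}, G \subset pairs 'I_n -> A G -> 1 <= f G) ->
  gnp_prob p A <= \sum_(G in powerset (pairs 'I_n)) gnp_weight p G * f G.
Proof.
move=> f0 f1; rewrite /gnp_prob big_mkcondr; apply: ler_sum => G.
rewrite powersetE => GP; case: ifP => AG.
  by rewrite ler_peMr ?gnp_weight_ge0 // f1.
by rewrite mulr_ge0 ?gnp_weight_ge0.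
Qed.

Lemma gnp_prob_le (A B : pred {set {set 'I_n}}) :
    (forall G : {set {set 'I_n}}, G \subset pairs 'I_n -> A G -> B G) ->
  gnp_prob p A <= gnp_prob p B.
Proof.
move=> AB; rewrite /gnp_prob !big_mkcondr; apply: ler_sum => G.
rewrite powersetE => GP; case: ifP => [/(AB _ GP)->//|_].
by case: ifP; rewrite ?gnp_weight_ge0.
Qed.

Lemma gnp_prob_ge0 (A : pred {set {set 'I_n}}) : 0 <= gnp_prob p A.
Proof. by apply: sumr_ge0 => G _; apply: gnp_weight_ge0. Qed.

Lemma gnp_prob_compl (A : pred {set {set 'I_n}}) :
  gnp_prob p (fun G => ~~ A G) = 1 - gnp_prob p A.
Proof.
rewrite -(gnp_prob_total n p) /gnp_prob.
apply/eqP; rewrite eq_sym subr_eq addrC; apply/eqP.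
by rewrite (bigID A); congr (_ + _); apply: eq_bigl => G; rewrite andbT.
Qed.

Lemma gnp_prob_union (I : finType) (D : pred I) (A : I -> pred {set {set 'I_n}}) :
  gnp_prob p (fun G => [exists i, D i && A i G]) <= \sum_(i | D i) gnp_prob p (A i).
Proof.
under [leRHS]eq_bigr do rewrite /gnp_prob big_mkcondr /=.
rewrite exchange_big /= /gnp_prob big_mkcondr; apply: ler_sum => G _.
have pos i : 0 <= (if A i G then gnp_weight p G else 0).
  by case: ifP; rewrite ?gnp_weight_ge0.
case: ifP => [/existsP[i /andP[Di AiG]]|_]; last exact: sumr_ge0.
by rewrite (bigD1 i) //= AiG lerDl sumr_ge0.
Qed.

(** Expanding the product of [f e + g e] gives one term per edge set; the zeros of [f] off [pairs]
    and of [g] on [F] leave exactly the graphs that contain [F]. *)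
Lemma gnp_prob_subset (F : {set {set 'I_n}}) : F \subset pairs 'I_n ->
  gnp_prob p (fun G => F \subset G) = p ^+ #|F|.
Proof.
move=> /subsetP FP.
pose f (e : {set 'I_n}) : R := if e \in pairs 'I_n then p else 0.
pose g (e : {set 'I_n}) : R :=
  if e \in pairs 'I_n then (if e \in F then 0 else 1 - p) else 1.
have -> : p ^+ #|F| = \prod_e (f e + g e).
  rewrite -prodr_const [LHS]big_mkcond; apply: eq_bigr => e _; rewrite /f /g.
  case: ifP => [/FP-> /[!addr0]//|_]; case: ifP; rewrite ?add0r // addrC subrK //.
rewrite bigA_distr /gnp_prob /gnp_weight big_mkcondr big_mkcond.
apply: eq_bigr => G _; rewrite powersetE; case: ifPn => [/subsetP sG|/subsetPn[e eG eP]].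
  case: ifPn => [/subsetP FG|/subsetPn[e eF eG]].
    rewrite big_mkcond; apply: eq_bigr => e _; rewrite /f /g.
    have := FG e; have := sG e.
    by do 3!case: (_ \in _); move=> //= h h'; (have := h isT) || (have := h' isT).
  by rewrite (bigD1 e) //= (negPf eG) /g eF FP // mul0r.
by rewrite (bigD1 e) //= eG /f (negPf eP) mul0r.
Qed.

Lemma sum_powerset_exp (J : finType) (X : {set J}) (w : R) :
  \sum_(Y in powerset X) w ^+ #|Y| = (1 + w) ^+ #|X|.
Proof.
pose f (j : J) := if j \in X then w else 0.
rewrite -prodr_const.
have -> : \prod_(j in X) (1 + w) = \prod_j (f j + 1).
  rewrite [LHS]big_mkcond; apply: eq_bigr => j _; rewrite /f.
  by case: ifP; rewrite ?add0r // addrC.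
rewrite bigA_distr big_mkcond; apply: eq_bigr => Y _; rewrite powersetE.
case: ifPn => [/subsetP YX|/subsetPn[j jY jX]]; last first.
  by rewrite (bigD1 j) //= jY /f (negPf jX) mul0r.
rewrite -prodr_const [LHS]big_mkcond; apply: eq_bigr => j _; rewrite /f.
by case: ifP => // /YX->.
Qed.

(** * A Chernoff bound for disjoint sets of pairs *)

Section Chernoff.

Variables (J : finType) (D : {set J}) (E : J -> {set {set 'I_n}}) (k : nat).
Hypotheses (E_pairs : forall j, j \in D -> E j \subset pairs 'I_n)
  (E_card : forall j, j \in D -> #|E j| = k)
  (E_disj : forall i j, i \in D -> j \in D -> i != j -> [disjoint E i & E j]).

(** By disjointness this is a binomial variable with parameters [#|D|] and [p ^+ k]. It is applied
    to single edges and to stars. *)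
Definition ncover (G : {set {set 'I_n}}) := #|[set j in D | E j \subset G]|.

(** The power expands into [w ^+ #|Y|] over the sets [Y] of covered indices, and a given [Y] is
    covered with probability [p ^+ (k * #|Y|)]. *)
Lemma gnp_mgf (w : R) :
  \sum_(G in powerset (pairs 'I_n)) gnp_weight p G * (1 + w) ^+ ncover G =
  (1 + w * p ^+ k) ^+ #|D|.
Proof.
rewrite -sum_powerset_exp.
under eq_bigr do rewrite -sum_powerset_exp big_distrr /=.
rewrite (exchange_big_dep (mem (powerset D))) /=; last first.
  move=> G Y _; rewrite !powersetE => /subset_trans; apply.
  by apply/subsetP => j; rewrite inE => /andP[].
apply: eq_bigr => Y; rewrite powersetE => /subsetP YD.
pose F := \bigcup_(j in Y) E j.
have cF : #|F| = (k * #|Y|)%N.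
  rewrite /F big_mkcond -sum1_card partition_disjoint_bigcup /=.
    rewrite mulnC -sum_nat_const [RHS]big_mkcond; apply: eq_bigr => j _.
    by case: ifP => [/YD jD|_]; rewrite ?big_set0 // sum1_card E_card.
  move=> i j ij; case: ifP => [/YD iD|_]; last by rewrite -setI_eq0 set0I.
  by case: ifP => [/YD jD|_]; [apply: E_disj | rewrite -setI_eq0 setI0].
rewrite exprMn -exprM -cF mulrC -gnp_prob_subset; last first.
  by apply/bigcupsP => j /YD; apply: E_pairs.
rewrite /gnp_prob big_distrl /=; apply: eq_bigl => G; congr (_ && _).
rewrite powersetE; apply/subsetP/bigcupsP => [YG j /YG|FG j jY].
  by rewrite inE => /andP[].
by rewrite inE YD //= FG.
Qed.

(** Markov's inequality for [(1 + w) ^+ ncover G]; the sign [sg] selects the upper or the lower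
    tail. *)
Lemma gnp_chernoff (sg e : R) : sg = 1 \/ sg = -1 -> 0 < e <= 1 ->
  gnp_prob p (fun G => e * #|D|%:R <= sg * ((ncover G)%:R - p ^+ k * #|D|%:R)) <=
  expR (- (e ^+ 2 / 8 * #|D|%:R)).
Proof.
move=> sg1 /andP[e0 e1]; set m := #|D|%:R : R; set q := p ^+ k.
(* The size [e / 4] minimises the final exponent [2 * w ^+ 2 - e * |w|], with value
   [- e ^+ 2 / 8]. *)
pose w := sg * (e / 4).
have [w_ge w_le sg2] : [/\ - (1 / 2) <= w, w <= 1 / 2 & sg * sg = 1].
  by rewrite /w; case: sg1 => ->; split; lra.
have exp_w : expR (w - 2 * w ^+ 2) <= 1 + w.
  have w1 : 0 < 1 + w by lra.
  rewrite -[w - _]opprK expRN -[leRHS]invrK lef_pV2 ?posrE ?expR_gt0 ?invr_gt0 //.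
  apply: le_trans (expR_ge1Dx _); rewrite -div1r ler_pdivrMr //.
  have : 0 <= w ^+ 2 * (1 + 2 * w) by rewrite mulr_ge0 ?sqr_ge0 //; lra.
  by lra.
have mgf_le : (1 + w * q) ^+ #|D| <= expR (w * q * m).
  rewrite /m expRM_natr lerXn2r ?nnegrE ?expR_ge0 ?expR_ge1Dx //.
  have q01 : 0 <= q <= 1 by rewrite exprn_ge0 ?exprn_ile1.
  by nra.
pose f G := (1 + w) ^+ ncover G * expR (2 * w ^+ 2 * m - w * q * m - e ^+ 2 / 4 * m).
apply: le_trans (gnp_prob_markov (f := f) _ _) _.
- by move=> G; rewrite mulr_ge0 ?expR_ge0 // exprn_ge0 //; lra.
- move=> G _ eG.
  apply: (@le_trans _ _ (expR (w - 2 * w ^+ 2) ^+ ncover G *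
      expR (2 * w ^+ 2 * m - w * q * m - e ^+ 2 / 4 * m))); last first.
    by rewrite ler_wpM2r ?expR_ge0 // lerXn2r ?nnegrE ?expR_ge0 //; lra.
  rewrite -expRM_natr -expRD -[leLHS]expR0 ler_expR.
  have N_le : (ncover G)%:R <= m.
    by rewrite ler_nat; apply/subset_leq_card/subsetP => j; rewrite inE => /andP[].
  have : 2 * w ^+ 2 * (ncover G)%:R <= 2 * w ^+ 2 * m.
    by rewrite ler_wpM2l // mulr_ge0 ?sqr_ge0.
  have : e / 4 * (e * m) <= e / 4 * (sg * ((ncover G)%:R - q * m)).
    by rewrite ler_wpM2l //; lra.
  by rewrite /w; lra.
rewrite /f; under eq_bigr do rewrite mulrA.
rewrite -big_distrl /= gnp_mgf -/q.
apply: le_trans (ler_wpM2r (expR_ge0 _) mgf_le) _.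
rewrite -expRD ler_expR.
have -> : w ^+ 2 = e ^+ 2 / 16.
  by rewrite /w exprMn expr2 sg2; field.
by lra.
Qed.

End Chernoff.

End Gnp.

(** The term of degree [k + 1] of the exponential series already dominates [n ^ k]. *)
Lemma exp_tail (R : realType) (c delta : R) (k : nat) : 0 < c -> 0 < delta ->
  exists n0 : nat, forall n : nat, (n0 <= n)%N ->
    n%:R ^+ k * expR (- (c * n%:R)) <= delta.
Proof.
move=> c0 d0; pose K := c ^+ k.+1 / k.+1`!%:R.
have K0 : 0 < K by rewrite divr_gt0 ?exprn_gt0 // ltr0n fact_gt0.
have [n0 n0_ge] := exists_natR_ge ((delta * K)^-1).
exists n0.+1 => n n0n.
have nR : 0 < n%:R :> R by rewrite ltr0n; apply: leq_trans n0n.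
have cn : 0 <= c * n%:R by rewrite mulr_ge0 // ltW.
rewrite expRN ler_pdivrMr ?expR_gt0 //.
have : K * n%:R ^+ k.+1 <= expR (c * n%:R).
  apply: le_trans (expR_ge1Dxn k cn); rewrite exprMn /K mulrAC.
  by rewrite lerDr.
have : 1 <= delta * K * n%:R.
  have dK : 0 < delta * K by rewrite mulr_gt0.
  rewrite mulrC -ler_pdivrMr // div1r (le_trans n0_ge) // ler_nat.
  exact: ltnW.
move=> h1 h2; apply: (@le_trans _ _ (delta * (K * n%:R ^+ k.+1))); last by rewrite ler_pM2l.
rewrite exprS !mulrA -[leLHS]mul1r ler_wpM2r ?exprn_ge0 //.
by move: h1; rewrite /K !mulrA.
Qed.

(** * Tail bounds for density and codegrees *)

Section Tails.

Variables (R : realType) (p : R) (n : nat).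
Hypothesis p01 : 0 < p < 1.

Lemma sum_nbr_inside (G : {set {set 'I_n}}) (X : {set 'I_n}) : G \subset pairs 'I_n ->
  (\sum_(u in X) #|nbr G u :&: X| =
   2 * #|[set e in [set e in pairs 'I_n | e \subset X] | [set e] \subset G]|)%N.
Proof.
move=> gG; set D := [set e in [set _ in _ | _] | _].
have gD : D \subset pairs 'I_n by apply/subsetP => e; rewrite !inE => /andP[/andP[]].
have memD u v : ([set u; v] \in D) = [&& [set u; v] \in G, u \in X & v \in X].
  rewrite in_set in_set sub1set andbC.
  case: (boolP ([set u; v] \in G)) => //= /(subsetP gG) ->.
  by rewrite subUset !sub1set.
rewrite -(handshake gD) big_mkcond; apply: eq_bigr => u _.
case: ifP => uX.
  by apply: eq_card => v; rewrite in_setI [v \in nbr D u]in_set memD uX in_set.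
by apply/esym/eqP; rewrite cards_eq0 -subset0; apply/subsetP => v; rewrite in_set memD uX andbF.
Qed.

(** The exponent is quadratic in [n] because [X] contains quadratically many pairs; this beats a
    union over [2 ^ n] sets. *)
Lemma sparse_prob_le (eta : R) (X : {set 'I_n}) :
    0 < eta <= 1 -> 2 <= eta ^+ 2 * n%:R -> eta * n%:R <= #|X|%:R ->
  gnp_prob p (fun G => (\sum_(u in X) #|nbr G u :&: X|)%:R < (p - eta) * #|X|%:R ^+ 2)
    <= expR (- (eta ^+ 4 / 128 * n%:R ^+ 2)).
Proof.
move=> /andP[eta0 eta1] n_ge X_ge; have /andP[p0 p1] := p01.
pose D := [set e in pairs 'I_n | e \subset X]; set x := #|X|%:R : R.
have x_ge : 2 <= eta * x.
  by apply: le_trans n_ge _; rewrite expr2 -mulrA ler_pM2l.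
have x0 : 0 < x by nra.
have cD : 2 * #|D|%:R = x * (x - 1).
  have x1 : (0 < #|X|)%N by rewrite -(ltr0n R).
  have -> : #|D| = 'C(#|X|, 2).
    by rewrite -cards_draws; apply: eq_card => e; rewrite !inE andbC.
  by rewrite -natrM -mul_bin_diag bin1 natrM -subn1 natrB.
pose E (e : {set 'I_n}) := [set e].
have E_pairs e : e \in D -> E e \subset pairs 'I_n.
  by rewrite inE sub1set => /andP[].
have E_card e : e \in D -> #|E e| = 1%N by rewrite cards1.
have E_disj e e' : e \in D -> e' \in D -> e != e' -> [disjoint E e & E e'].
  by move=> _ _ ne; rewrite /E disjoints1 inE.
(* Half of [eta] is the deviation; the other half absorbs the difference between [x ^ 2] and
   [x * (x - 1)]. *)
have eta2 : 0 < eta / 2 <= 1 by lra.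
have := gnp_chernoff p01 E_pairs E_card E_disj (or_intror erefl) eta2.
rewrite expr1 => chern; apply: le_trans (gnp_prob_le p01 _) (le_trans chern _).
  move=> G gG; rewrite (sum_nbr_inside _ gG) -/D natrM => lt_N.
  have -> : ncover D E G = #|[set e in D | [set e] \subset G]| by [].
  have : 2 * p * #|D|%:R = p * (x * (x - 1)) by rewrite -cD; ring.
  have : eta * #|D|%:R <= eta * x ^+ 2 / 2.
    have -> : eta * #|D|%:R = eta / 2 * (2 * #|D|%:R) by field.
    rewrite cD [leRHS](_ : _ = eta / 2 * (x * x)); last by field.
    have e2 : 0 < eta / 2 by lra.
    by rewrite ler_pM2l // ler_pM2l //; lra.
  have : 2 * x <= eta * x ^+ 2 by rewrite expr2 mulrA ler_pM2r.
  have : p * x <= x by rewrite ler_piMl ?ltW.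
  by move: lt_N; rewrite -/x; lra.
rewrite ler_expR lerN2.
have D_ge : x ^+ 2 / 4 <= #|D|%:R by nra.
apply: (@le_trans _ _ ((eta / 2) ^+ 2 / 8 * (x ^+ 2 / 4))); last first.
  by rewrite ler_wpM2l // divr_ge0 ?sqr_ge0.
have -> : (eta / 2) ^+ 2 / 8 * (x ^+ 2 / 4) = eta ^+ 2 / 128 * x ^+ 2 by field.
have -> : eta ^+ 4 / 128 * n%:R ^+ 2 = eta ^+ 2 / 128 * (eta * n%:R) ^+ 2 by field.
rewrite ler_wpM2l ?divr_ge0 ?sqr_ge0 // lerXn2r ?nnegrE //.
by rewrite mulr_ge0 // ltW.
Qed.

(** The stars joining the vertices outside [Q] to [Q] are disjoint sets of [s] pairs, and at least
    [n / 2] vertices lie outside [Q]. *)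
Lemma codegree_prob_le (eta : R) (s : nat) (Q : {set 'I_n}) :
    0 < eta <= 1 -> (2 * s <= n)%N -> #|Q| = s ->
  gnp_prob p (fun G => (p ^+ s + eta) * n%:R < #|cnbr G Q|%:R)
    <= expR (- (eta ^+ 2 / 16 * n%:R)).
Proof.
move=> eta01 sn cQ; have /andP[eta0 eta1] := eta01; have /andP[p0 p1] := p01.
pose E (v : 'I_n) := [set [set v; q] | q in Q].
have vQ v q : v \in ~: Q -> q \in Q -> v != q.
  by rewrite inE => vQ qQ; apply: contraNneq vQ => ->.
have E_pairs v : v \in ~: Q -> E v \subset pairs 'I_n.
  move=> vNQ; apply/subsetP => _ /imsetP[q qQ ->].
  by rewrite inE cards2 vQ.
have E_card v : v \in ~: Q -> #|E v| = s.
  move=> vNQ; rewrite card_in_imset // => q q' qQ q'Q /setP/(_ q).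
  rewrite !inE eqxx orbT [q == v]eq_sym (negPf (vQ _ _ vNQ qQ)) /=.
  by move/esym/eqP.
have E_disj v v' : v \in ~: Q -> v' \in ~: Q -> v != v' -> [disjoint E v & E v'].
  move=> vNQ v'NQ ne; rewrite -setI_eq0; apply/eqP/setP => e; rewrite !inE.
  apply/negP => /andP[/imsetP[q qQ ->] /imsetP[q' q'Q /setP/(_ v)]].
  by rewrite !inE eqxx (negPf ne) (negPf (vQ _ _ vNQ q'Q)).
have := gnp_chernoff p01 E_pairs E_card E_disj (or_introl erefl) eta01.
have cC : #|~: Q|%:R = n%:R - s%:R :> R.
  rewrite -natrB; last by apply: leq_trans sn; rewrite leq_pmull.
  congr (_%:R); have := cardsC Q.
  by rewrite card_ord cQ => /(congr1 (subn^~ s)); rewrite addKn.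
move=> chern; apply: le_trans (gnp_prob_le p01 _) (le_trans chern _).
  move=> G gG lt_N; rewrite mul1r.
  have le_N : #|cnbr G Q|%:R <= (ncover (~: Q) E G)%:R :> R.
    rewrite ler_nat; apply/subset_leq_card/subsetP => v; rewrite !inE => /subsetP Qv.
    apply/andP; split.
      by apply/negP => /Qv; rewrite nbr_irr.
    by apply/subsetP => _ /imsetP[q /Qv + ->]; rewrite inE.
  have C_le : #|~: Q|%:R <= n%:R :> R by rewrite cC lerBlDr lerDl.
  have pe : 0 <= p ^+ s + eta by rewrite addr_ge0 ?exprn_ge0 ?ltW.
  have := ler_wpM2l pe C_le.
  by lra.
rewrite ler_expR lerN2 cC.
have : (2 * s)%:R <= n%:R :> R by rewrite ler_nat.
rewrite natrM => sR.
apply: (@le_trans _ _ (eta ^+ 2 / 8 * (n%:R / 2))); first by lra.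
by rewrite ler_wpM2l ?divr_ge0 ?sqr_ge0 //; lra.
Qed.

End Tails.

Lemma sat_prob (R : realType) (p eps delta : R) (s t : nat) :
    0 < p < 1 -> (2 <= s)%N -> (s <= t)%N -> 0 < eps -> 0 < delta ->
  exists n0 : nat, forall n : nat, (n0 <= n)%N ->
    gnp_prob p (fun G : {set {set 'I_n}} =>
      ~~ ((sat_const p s t - eps) * n%:R <= (sat G (Kst s t))%:R)) <= delta.
Proof.
move=> p01 s2 st eps0 delta0.
have [eta' [n0 [eta'0 det]]] := sat_ge p01 s2 st eps0.
pose eta := Num.min eta' 1.
have eta0 : 0 < eta by rewrite lt_min eta'0 /=.
have eta1 : eta <= 1 by rewrite ge_min lexx orbT.
have etale : eta <= eta' by rewrite ge_min lexx.
have d2 : 0 < delta / 2 by rewrite divr_gt0.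
have [n1 tail1] := @exp_tail R 1 _ 0 ltr01 d2.
have c2 : 0 < eta ^+ 2 / 16 by rewrite divr_gt0 // exprn_gt0.
have [n2 tail2] := @exp_tail R _ _ s c2 d2.
have [n3 n3_ge] := exists_natR_ge (2 / eta ^+ 2).
(* Makes the exponent at least [2 * n], which beats the [2 ^ n <= expR n] choices of [X]. *)
have [n4 n4_ge] := exists_natR_ge (2 / (eta ^+ 4 / 128)).
exists (n0 + n1 + n2 + n3 + n4 + 2 * s)%N => n n_ge.
have [ge0 ge1 ge2 [ge3 ge4 ge5]] : [/\ (n0 <= n)%N, (n1 <= n)%N, (n2 <= n)%N &
    [/\ (n3 <= n)%N, (n4 <= n)%N & (2 * s <= n)%N]].
  by move: n_ge; clear; split; [lia|lia|lia|split; lia].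
pose sparse (X : {set 'I_n}) (G : {set {set 'I_n}}) :=
  (\sum_(u in X) #|nbr G u :&: X|)%:R < (p - eta) * #|X|%:R ^+ 2.
pose heavy (Q : {set 'I_n}) (G : {set {set 'I_n}}) :=
  (p ^+ s + eta) * n%:R < #|cnbr G Q|%:R.
pose bad1 (G : {set {set 'I_n}}) :=
  [exists X : {set 'I_n}, (eta * n%:R <= #|X|%:R) && sparse X G].
pose bad2 (G : {set {set 'I_n}}) := [exists Q : {set 'I_n}, (#|Q| == s) && heavy Q G].
have bad1_le : gnp_prob p bad1 <= delta / 2.
  apply: le_trans (gnp_prob_union p01 _ _) _.
  have le_exp (X : {set 'I_n}) : eta * n%:R <= #|X|%:R ->
      gnp_prob p (sparse X) <= expR (- (eta ^+ 4 / 128 * n%:R ^+ 2)).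
    apply: sparse_prob_le => //; first by rewrite eta0.
    rewrite mulrC -ler_pdivrMr ?exprn_gt0 //; apply: le_trans n3_ge _.
    by rewrite ler_nat.
  apply: (@le_trans _ _ (\sum_(X : {set 'I_n} | eta * n%:R <= #|X|%:R)
      expR (- (eta ^+ 4 / 128 * n%:R ^+ 2)))); first exact: ler_sum.
  apply: (@le_trans _ _ (\sum_(X : {set 'I_n}) expR (- (eta ^+ 4 / 128 * n%:R ^+ 2)))).
    rewrite [leRHS](bigID (fun X : {set 'I_n} => eta * n%:R <= #|X|%:R)) /= lerDl.
    by rewrite sumr_ge0 // => X _; apply: expR_ge0.
  rewrite sumr_const; have -> : #|{set 'I_n}| = (2 ^ n)%N.
    by rewrite -cardsT -powersetT card_powerset cardsT card_ord.
  rewrite -[leLHS]mulr_natl natrX; have := tail1 _ ge1; rewrite expr0 mul1r.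
  apply: le_trans.
  have two_le : (2 : R) ^+ n <= expR n%:R.
    rewrite -[X in expR X]mul1r expRM_natr lerXn2r ?nnegrE ?expR_ge0 //.
    by apply: le_trans (expR_ge1Dx 1).
  apply: le_trans (ler_wpM2r (expR_ge0 _) two_le) _.
  rewrite -expRD ler_expR mul1r.
  have c0 : 0 < eta ^+ 4 / 128 by rewrite divr_gt0 // exprn_gt0.
  have : 2 <= eta ^+ 4 / 128 * n%:R.
    by rewrite mulrC -ler_pdivrMr //; apply: le_trans n4_ge _; rewrite ler_nat.
  by move=> h; have := ler_wpM2r (ler0n R n) h; lra.
have bad2_le : gnp_prob p bad2 <= delta / 2.
  apply: le_trans (gnp_prob_union p01 _ _) _.
  have le_exp (Q : {set 'I_n}) : #|Q| == s ->
      gnp_prob p (heavy Q) <= expR (- (eta ^+ 2 / 16 * n%:R)).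
    by move=> /eqP cQ; apply: codegree_prob_le => //; rewrite eta0.
  apply: (@le_trans _ _ (\sum_(Q : {set 'I_n} | #|Q| == s)
      expR (- (eta ^+ 2 / 16 * n%:R)))); first exact: ler_sum.
  apply: le_trans (tail2 _ ge2).
  rewrite sumr_const -[leLHS]mulr_natl ler_wpM2r ?expR_ge0 // -natrX ler_nat.
  have -> : #|[pred Q : {set 'I_n} | #|Q| == s]| = 'C(n, s).
    rewrite -[n in RHS]card_ord -cardsT -cards_draws; apply: eq_card => Q.
    by rewrite !inE subsetT.
  apply: (@leq_trans (n ^_ s)); first by rewrite -bin_ffact leq_pmulr // fact_gt0.
  rewrite ffact_prod -[s in (_ ^ s)%N]card_ord -prod_nat_const.
  by apply: leq_prod => i _; apply: leq_subr.
rewrite [delta]splitr; apply: le_trans (lerD bad1_le bad2_le).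
apply: (@le_trans _ _ (gnp_prob p (fun G =>
  [exists b : bool, true && (if b then bad1 G else bad2 G)]))).
  apply: gnp_prob_le => // G gG; apply: contraR => none; have cT := card_ord n.
  have nb (b : bool) : ~~ (if b then bad1 G else bad2 G).
    by apply: contra none => h; apply/existsP; exists b.
  have := det _ G; rewrite cT; apply => //.
  - move=> X X_ge; rewrite cT in X_ge; apply: (@le_trans _ _ ((p - eta) * #|X|%:R ^+ 2)).
      by rewrite ler_wpM2r ?exprn_ge0 //; lra.
    rewrite leNgt; apply: contra (nb true) => lt_X; apply/existsP; exists X.
    by rewrite /sparse lt_X andbT; apply: le_trans X_ge; rewrite ler_wpM2r.
  - move=> Q cQ; rewrite cT; apply: (@le_trans _ _ ((p ^+ s + eta) * n%:R)).
      rewrite leNgt; apply: contra (nb false) => lt_Q; apply/existsP; exists Q.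
      by rewrite cQ eqxx.
    by rewrite ler_wpM2r // lerD2l.
apply: le_trans (gnp_prob_union p01 _ _) _.
by rewrite big_bool.
Qed.

(** * From fixed errors to an error tending to 0 *)

Local Open Scope classical_set_scope.

Lemma diagonal_seq (R : realType) (F : R -> nat -> R) :
    (forall e n, 0 <= F e n <= 1) ->
    (forall e, 0 < e -> exists n0 : nat, forall n, (n0 <= n)%N -> F e n <= e) ->
  exists eps : nat -> R, eps @ \oo --> (0 : R) /\ F (eps n) n @[n --> \oo] --> (0 : R).
Proof.
move=> F01 small; pose inv (k : nat) : R := k.+1%:R^-1.
pose P n (k : 'I_n.+1) := F (inv k) n <= inv k.
(* The index 0 always qualifies, since [inv 0] is 1 and [F] is at most 1; so the maximum below
   exists. *)
have P0 n : P n ord0 by rewrite /P /inv invr1; case/andP: (F01 1 n).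
(* The best bound [1 / (k + 1)] with [k <= n] that [F] already satisfies at [n]. *)
pose eps n := inv [arg max_(k > ord0 | P n k) k]%N.
have eps_gt0 n : 0 < eps n by rewrite invr_gt0.
have F_le n : F (eps n) n <= eps n.
  by rewrite /eps; case: arg_maxnP => // k Pk _.
have eps_small e : 0 < e -> exists n0 : nat, forall n, (n0 <= n)%N -> eps n <= e.
  move=> e0; have [K K_ge] := exists_natR_ge e^-1.
  have invK : inv K <= e.
    rewrite -[leRHS]invrK lef_pV2 ?posrE ?invr_gt0 //.
    by rewrite (le_trans K_ge) // ler_nat.
  have invK0 : 0 < inv K by rewrite invr_gt0.
  have [n0 n0_small] := small (inv K) invK0.
  exists (maxn n0 K) => n; rewrite geq_max => /andP[n0n Kn].
  apply: le_trans invK; rewrite /eps; case: arg_maxnP => // k _ kmax.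
  have /= Kk := kmax (Ordinal (Kn : (K < n.+1)%N)) (n0_small n n0n).
  by rewrite lef_pV2 ?posrE // ler_nat ltnS.
exists eps; split; apply/cvgrPdist_le => /= e e0; have [n0 le_e] := eps_small e e0;
  exists n0 => //= n n0n; rewrite sub0r normrN.
  by rewrite gtr0_norm // le_e.
have /andP[F0 _] := F01 (eps n) n.
by rewrite ger0_norm // (le_trans (F_le n)) // le_e.
Qed.

Theorem theorem1p2 (R : realType) (s t : nat) (p : R)
    (hs : (2 <= s)%N) (hst : (s <= t)%N) (hp : 0 < p < 1) :
  exists eps : nat -> R,
    (eps @ \oo --> (0 : R)) /\
    whp p (fun (n : nat) (G : {set {set 'I_n}}) =>
      (Num.max ((2 * s%:R + t%:R - 3) / 2)
               ((t%:R - s%:R) / (4 * p ^+ (s - 1)) + (s%:R - 1) / 2)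
       + eps n) * n%:R <= (sat G (Kst s t))%:R).
Proof.
pose F (e : R) n := gnp_prob p (fun G : {set {set 'I_n}} =>
  ~~ ((sat_const p s t - e) * n%:R <= (sat G (Kst s t))%:R)).
have [||eps [eps0 F0]] := @diagonal_seq R F.
- move=> e n; rewrite /F gnp_prob_ge0 //= -[leRHS](gnp_prob_total n p).
  exact: gnp_prob_le.
- by move=> e e0; apply: sat_prob.
exists (fun n => - eps n); split; first by rewrite -oppr0; apply: cvgN.
rewrite /whp; set good := (X in X @ \oo --> _).
have -> : good = (fun n => 1 - F (eps n) n).
  apply/funext => n; rewrite /F gnp_prob_compl //.
  by rewrite subKr.
by rewrite -[X in _ --> X]subr0; apply: cvgB => //; apply: cvg_cst.
Qed.
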